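(* Suppose that (i) $g_0(\boldsymbol\gamma)$ is polyhedral with parameter $\rho=\Theta(1)>0$, i.e. $g_0(\boldsymbol\gamma_0^* )\ge g_0(\boldsymbol\gamma)+\rho\|\boldsymbol\gamma_0^*-\boldsymbol\gamma\|$ for all $\boldsymbol\gamma$, and (ii) the effective backlog process $\boldsymbol Q(t)$ has a countable state space under the algorithm OLAC. Then, with a sufficiently large $V$ and $\theta_j=[\log(V)]^2$ for all $j$, with probability 1, $$f^{\mathrm{OLAC}}_{\mathrm{av}}=f^*_{\mathrm{av}}+O\!\left(\frac1V\right),$$ where $f^{\mathrm{OLAC}}_{\mathrm{av}}=\limsup_{t\to\infty}\frac1t\sum_{\tau=0}^{t-1}\mathbb E\{f(\tau)\}$ is the time average cost under OLAC.
   Context: **Model.** Time is slotted, $t=0,1,2,\dots$; there are $r\ge1$ queues. The network state $S(t)$ is i.i.d. over time with values in $\{s_1,\dots,s_M\}$, $\pi_{s_i}=\Pr\{S(t)=s_i\}$, $\boldsymbol\pi=(\pi_{s_1},\dots,\pi_{s_M})$. The controller observes $S(t)$ at the start of slot $t$ but does not know $\boldsymbol\pi$. If $S(t)=s_i$ it chooses an action $x(t)$ in a time-invariant compact set $\mathcal X^{(s_i)}$; an action $x$ gives cost $f(t)=f(s_i,x)$ (costs are all in $\mathbb R_+$, or all in $\mathbb R_-$ for reward maximization problems), traffic $A_j(t)=A_j(s_i,x)\ge0$ to queue $j$, and service $\mu_j(t)=\mu_j(s_i,x)\ge0$ to queue $j$. The magnitudes of all functions $f,A_j,\mu_j$ are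 bounded by a constant $\delta_{\max}\in(0,\infty)$, and the functions are known to the controller. Queues: $q_j(t+1)=\max[q_j(t)-\mu_j(t)+A_j(t),0]$, $\boldsymbol q(0)=\boldsymbol0$. A feasible policy is stable if $\limsup_{t\to\infty}\frac1t\sum_{\tau<t}\sum_j\mathbb E\{q_j(\tau)\}<\infty$; $f^*_{\mathrm{av}}$ is the optimal (minimal) value of $\limsup_{t\to\infty}\frac1t\sum_{\tau<t}\mathbb E\{f(\tau)\}$ over all stable policies. **Dual functions.** $V\ge1$ is a parameter. For $\boldsymbol\gamma\in\mathbb R^r$, $g_{s_i}(\boldsymbol\gamma)=\inf_{x\in\mathcal X^{(s_i)}}\{Vf(s_i,x)+\sum_j\gamma_j[A_j(s_i,x)-\mu_j(s_i,x)]\}$ and $g(\boldsymbol\gamma)=\sum_{s_i}\pi_{s_i}g_{s_i}(\boldsymbol\gamma)$. $g_0$ denotes $g$ with $V=1$; $\boldsymbol\gamma^*$ and $\boldsymbol\gamma_0^*$ denote maximizers over $\boldsymbol\gamma\succeq\boldsymbol0$ of $g$ and $g_0$ respectively, with $\boldsymbol\gamma^*=V\boldsymbol\gamma_0^*$. $\|\cdot\|$ is the Euclidean norm. **Standing assumptions.** (A1) There is $\epsilon_s=\Theta(1)>0$ such that for every state distribution $\boldsymbol\pi'$ with $\|\boldsymbol\pi'-\boldsymbol\pi\|\le\epsilon_s$ there are actions $x_k^{(s_i)}\in\mathcal X^{(s_i)}$ and weights $\vartheta_k^{(s_i)}\ge0$, $k=1,2,\dots$, with $\sum_k\vartheta_k^{(s_i)}=1$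 for all $s_i$ (possibly depending on $\boldsymbol\pi'$), with $\sum_{s_i}\pi'_{s_i}\sum_k\vartheta_k^{(s_i)}[A_j(s_i,x_k^{(s_i)})-\mu_j(s_i,x_k^{(s_i)})]\le-\eta_0$ for all $j$, where $\eta_0=\Theta(1)>0$ is independent of $\boldsymbol\pi'$. (A2) There are actions $x_k^{(s_i)*}\in\mathcal X^{(s_i)}$ and weights $\vartheta_k^{(s_i)*}\ge0$ with $\sum_k\vartheta_k^{(s_i)*}=1$ for all $s_i$, such that $\sum_{s_i}\pi_{s_i}\sum_k\vartheta_k^{(s_i)*}f(s_i,x_k^{(s_i)*})=f^*_{\mathrm{av}}$ and $\sum_{s_i}\pi_{s_i}\sum_k\vartheta_k^{(s_i)*}[A_j(s_i,x_k^{(s_i)*})-\mu_j(s_i,x_k^{(s_i)*})]=0$ for all $j$. (A3) $\boldsymbol\gamma_0^*$ is the unique maximizer of $g_0$ in $\mathbb R^r$. **Algorithm OLAC** (parameter $\boldsymbol\theta=(\theta_1,\dots,\theta_r)>0$). Let $\pi_{s_i}(t)=N_{s_i}(t)/t$, where $N_{s_i}(t)$ is the number of slots in $\{0,\dots,t-1\}$ with $S=s_i$. In every slot $t$: (1) let $\boldsymbol\beta(t)$ be an optimal solution of $\max_{\boldsymbol\beta\succeq\boldsymbol0}g(\boldsymbol\beta,t)$, $g(\boldsymbol\beta,t):=\sum_{s_i}\pi_{s_i}(t)g_{s_i}(\boldsymbol\beta)$; (2) set the effective backlog $Q_j(t)=q_j(t)+\beta_j(t)-\theta_j$ and, if $S(t)=s_i$,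 choose $x\in\mathcal X^{(s_i)}$ maximizing $-Vf(s_i,x)+\sum_jQ_j(t)[\mu_j(s_i,x)-A_j(s_i,x)]$; (3) update the queues. $O(\cdot)$ and $\Theta(\cdot)$ are with respect to $V$; in particular $\Theta(1)$ means a constant not depending on $V$. *)

(* Defs.v *)
From HB Require Import structures.
From mathcomp Require Import all_boot all_order all_algebra.
From mathcomp Require Import all_classical all_reals all_analysis.

Set Implicit Arguments.
Unset Strict Implicit.
Unset Printing Implicit Defensive.

Import Order.TTheory GRing.Theory Num.Theory.
Import numFieldNormedType.Exports.

Local Open Scope classical_set_scope.
Local Open Scope ring_scope.

(* The library norm on row vectors is the max norm. *)
Definition enorm (R : realType) (n : nat) (v : 'rV[R]_n) : R :=
  Num.sqrt (\sum_(j < n) v 0 j ^+ 2).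

Definition nonneg_vec (R : realType) (n : nat) (v : 'rV[R]_n) : Prop :=
  forall j, 0 <= v 0 j.

Definition distribution_vec (R : realType) (n : nat) (p : 'rV[R]_n) : Prop :=
  nonneg_vec p /\ \sum_(i < n) p 0 i = 1.

(* r queues and M network states.  [service] and [arrival] are the vectors
   (mu_j(s_i, x))_j and (A_j(s_i, x))_j. *)
Record network (R : realType) (r M : nat) (T : topologicalType) := Network {
  actions : 'I_M -> set T;
  cost : 'I_M -> T -> R;
  arrival : 'I_M -> T -> 'rV[R]_r;
  service : 'I_M -> T -> 'rV[R]_r
}.

Definition network_axioms (R : realType) (r M : nat) (T : topologicalType)
    (net : network R r M T) (delta : R) : Prop :=
  [/\ forall i, compact (actions net i),
      (forall i x, actions net i x -> 0 <= cost net i x) \/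
      (forall i x, actions net i x -> cost net i x <= 0),
      forall i x, actions net i x -> `|cost net i x| <= delta,
      forall i x j, actions net i x -> 0 <= arrival net i x 0 j <= delta
    & forall i x j, actions net i x -> 0 <= service net i x 0 j <= delta].

Definition state_dual (R : realType) (r M : nat) (T : topologicalType)
    (net : network R r M T) (V : R) (i : 'I_M) (gamma : 'rV[R]_r) : R :=
  inf [set V * cost net i x
           + \sum_(j < r) gamma 0 j * (arrival net i x 0 j - service net i x 0 j)
      | x in actions net i].

Definition dual (R : realType) (r M : nat) (T : topologicalType)
    (net : network R r M T) (p : 'rV[R]_M) (V : R) (gamma : 'rV[R]_r) : R :=
  \sum_(i < M) p 0 i * state_dual net V i gamma.

(* For every state i, a countable mixture of actions x i k with weights w i k;
   finite mixtures are those with finitely many nonzero weights. *)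
Definition mixture (R : realType) (r M : nat) (T : topologicalType)
    (net : network R r M T) (x : 'I_M -> nat -> T) (w : 'I_M -> nat -> R) : Prop :=
  forall i, [/\ forall k, actions net i (x i k),
                forall k, 0 <= w i k
              & series (w i) @ \oo --> (1 : R)].

(* The inner series converges absolutely for a mixture and a bounded h. *)
Definition mixture_mean (R : realType) (M : nat) (T : topologicalType)
    (p : 'rV[R]_M) (x : 'I_M -> nat -> T) (w : 'I_M -> nat -> R)
    (h : 'I_M -> T -> R) : R :=
  \sum_(i < M) p 0 i * limn (series (fun k => w i k * h i (x i k))).

Definition slackness (R : realType) (r M : nat) (T : topologicalType)
    (net : network R r M T) (p : 'rV[R]_M) (eps eta : R) : Prop :=
  forall p' : 'rV[R]_M, distribution_vec p' -> enorm (p' - p) <= eps ->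
  exists (x : 'I_M -> nat -> T) (w : 'I_M -> nat -> R),
    mixture net x w /\
    forall j, mixture_mean p' x w
                (fun i y => arrival net i y 0 j - service net i y 0 j) <= - eta.

(* [info t] is the sigma-algebra of the events known to the controller at the
   start of slot t, before S(t) is observed, including its own randomization. *)
Record controlled_process (M : nat) (T : Type)
    (d : measure_display) (Omega : measurableType d) := ControlledProcess {
  state : nat -> Omega -> 'I_M;
  action : nat -> Omega -> T;
  info : nat -> set (set Omega)
}.

Definition adapted_to (R : realType) (Omega : Type) (G : set (set Omega))
    (h : Omega -> R) : Prop :=
  forall B : set R, measurable B -> G (h @^-1` B).

(* S(t) has law p and is independent of [info t], and [info t] contains the
   events about S(0), ..., S(t-1): the state process is i.i.d. with law p.
   The action of slot t belongs to the information of slot t+1, so it may depend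
   on the past, on S(t) and on a randomization, but not on future states.
   Only the cost, arrivals and services of the chosen action need to be
   measurable: the action space carries no sigma-algebra. *)
Definition feasible (R : realType) (r M : nat) (T : topologicalType)
    (net : network R r M T) (p : 'rV[R]_M) (d : measure_display)
    (Omega : measurableType d) (P : probability Omega R)
    (u : controlled_process M T Omega) : Prop :=
  [/\ forall t, sigma_algebra [set: Omega] (info u t) /\
                info u t `<=` (@measurable d Omega),
      forall t, info u t `<=` info u t.+1,
      forall t i, info u t.+1 [set w | state u t w = i],
      forall t i B, info u t B ->
        P (B `&` [set w | state u t w = i]) = (P B * (p 0 i)%:E)%E
    & (forall t w, actions net (state u t w) (action u t w)) /\
      forall t,
        [/\ adapted_to (info u t.+1)
              (fun w => cost net (state u t w) (action u t w)),
            forall j, adapted_to (info u t.+1)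
              (fun w => arrival net (state u t w) (action u t w) 0 j)
          & forall j, adapted_to (info u t.+1)
              (fun w => service net (state u t w) (action u t w) 0 j)]].

Fixpoint queue (R : realType) (r M : nat) (T : topologicalType)
    (net : network R r M T) (d : measure_display) (Omega : measurableType d)
    (u : controlled_process M T Omega) (t : nat) (w : Omega) : 'rV[R]_r :=
  match t with
  | 0%N => 0
  | t'.+1 => \row_(j < r)
      Num.max (queue net u t' w 0 j
               - service net (state u t' w) (action u t' w) 0 j
               + arrival net (state u t' w) (action u t' w) 0 j) 0
  end.

Definition time_average (R : realType) (a : nat -> \bar R) : \bar R :=
  limn_esup (fun t => ((t%:R^-1)%:E * \sum_(tau < t) a tau)%E).

Definition average_cost (R : realType) (r M : nat) (T : topologicalType)
    (net : network R r M T) (d : measure_display) (Omega : measurableType d)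
    (P : probability Omega R) (u : controlled_process M T Omega) : \bar R :=
  time_average (fun tau =>
    'E_P[fun w => cost net (state u tau w) (action u tau w)])%E.

Definition stable (R : realType) (r M : nat) (T : topologicalType)
    (net : network R r M T) (d : measure_display) (Omega : measurableType d)
    (P : probability Omega R) (u : controlled_process M T Omega) : Prop :=
  (time_average (fun tau =>
    \sum_(j < r) 'E_P[fun w => (queue net u tau w 0 j)%R]) < +oo)%E.

Definition optimal_cost (R : realType) (r M : nat) (T : topologicalType)
    (net : network R r M T) (p : 'rV[R]_M) : \bar R :=
  ereal_inf [set c | exists (d : measure_display) (Omega : measurableType d)
      (P : probability Omega R) (u : controlled_process M T Omega),
      [/\ feasible net p P u, stable net P u & c = average_cost net P u]].

Definition zero_drift_optimum (R : realType) (r M : nat) (T : topologicalType)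
    (net : network R r M T) (p : 'rV[R]_M) : Prop :=
  exists (x : 'I_M -> nat -> T) (w : 'I_M -> nat -> R),
    [/\ mixture net x w,
        (mixture_mean p x w (cost net))%:E = optimal_cost net p
      & forall j, mixture_mean p x w
          (fun i y => arrival net i y 0 j - service net i y 0 j) = 0].

Definition unique_dual_maximizer (R : realType) (r M : nat)
    (T : topologicalType) (net : network R r M T) (p : 'rV[R]_M)
    (gamma0 : 'rV[R]_r) : Prop :=
  nonneg_vec gamma0 /\
  forall gamma, gamma != gamma0 -> dual net p 1 gamma < dual net p 1 gamma0.

Definition polyhedral (R : realType) (r M : nat) (T : topologicalType)
    (net : network R r M T) (p : 'rV[R]_M) (gamma0 : 'rV[R]_r) (rho : R) : Prop :=
  forall gamma,
    dual net p 1 gamma + rho * enorm (gamma0 - gamma) <= dual net p 1 gamma0.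

(* pi(0) is the null vector, since division by zero yields zero; every
   beta >= 0 is then a solution of the dual problem of slot 0. *)
Definition empirical_dist (R : realType) (M : nat) (T : Type)
    (d : measure_display) (Omega : measurableType d)
    (u : controlled_process M T Omega) (t : nat) (w : Omega) : 'rV[R]_M :=
  \row_(i < M) ((\sum_(tau < t) (state u tau w == i))%N%:R / t%:R).

Definition dual_solution (R : realType) (r M : nat) (T : topologicalType)
    (net : network R r M T) (p : 'rV[R]_M) (V : R) (beta : 'rV[R]_r) : Prop :=
  nonneg_vec beta /\
  forall b, nonneg_vec b -> dual net p V b <= dual net p V beta.

Definition effective_backlog (R : realType) (r M : nat) (T : topologicalType)
    (net : network R r M T) (theta : 'rV[R]_r) (d : measure_display)
    (Omega : measurableType d) (u : controlled_process M T Omega)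
    (beta : nat -> Omega -> 'rV[R]_r) (t : nat) (w : Omega) : 'rV[R]_r :=
  queue net u t w + beta t w - theta.

(* The empirical dual problem may be unbounded in early slots (for instance when
   only overloaded states have been seen) and then has no optimal solution; in
   such slots beta(t) is any nonnegative vector determined by the past. *)
Definition olac (R : realType) (r M : nat) (T : topologicalType)
    (net : network R r M T) (V : R) (theta : 'rV[R]_r) (d : measure_display)
    (Omega : measurableType d) (u : controlled_process M T Omega)
    (beta : nat -> Omega -> 'rV[R]_r) : Prop :=
  [/\ forall t j, adapted_to (info u t) (fun w => beta t w 0 j),
      forall t w, nonneg_vec (beta t w) /\
        ((exists b, dual_solution net (empirical_dist R u t w) V b) ->
         dual_solution net (empirical_dist R u t w) V (beta t w))
    & forall t w,
        let Q := effective_backlog net theta u beta t w in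
        let payoff x := - V * cost net (state u t w) x
          + \sum_(j < r) Q 0 j * (service net (state u t w) x 0 j
                                  - arrival net (state u t w) x 0 j) in
        forall x, actions net (state u t w) x -> payoff x <= payoff (action u t w)].

Definition countable_state_space (R : realType) (r M : nat)
    (T : topologicalType) (net : network R r M T) (theta : 'rV[R]_r)
    (d : measure_display) (Omega : measurableType d)
    (u : controlled_process M T Omega) (beta : nat -> Omega -> 'rV[R]_r) : Prop :=
  countable [set Q | exists t w, effective_backlog net theta u beta t w = Q].

(* Main.v *)
(* Polyhedrality makes the dual maximizer g = V gamma0 insensitive to small
   perturbations of the state distribution, so beta(t) = g outside an event
   whose probability decays exponentially in t, by a Chernoff bound.  When
   beta(t) = g, the increment of the queues under OLAC is a supergradient of the
   dual function at Q(t) = g + q(t) - theta, so polyhedrality gives the distance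
   Y(t) from q(t) to theta a negative drift as soon as Y(t) exceeds a constant.
   Hence, for a constant K independent of V, the time average of E exp(K Y(t))
   is bounded uniformly in V.  This yields stability, which makes the optimal
   cost a lower bound, and shows that service is wasted with frequency at most a
   constant times exp(- K (ln V)^2) <= 1 / V.  For the upper bound, use
   drift-plus-penalty with the potential Y^2 / 2 + g . q: its linear part absorbs
   the drift in the direction g, which is of order V, up to g times the wasted
   service, which is O(1). *)
Require Import Defs.
From HB Require Import structures.
From mathcomp Require Import all_boot all_order all_algebra.
From mathcomp Require Import all_classical all_reals all_analysis.
From mathcomp Require Import measurable_realfun ring lra.

Set Implicit Arguments.
Unset Strict Implicit.
Unset Printing Implicit Defensive.

Import Order.TTheory GRing.Theory Num.Theory.
Import numFieldNormedType.Exports.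

Local Open Scope classical_set_scope.
Local Open Scope ring_scope.

(** * Euclidean vectors and the dual function *)

Section euclidean.
Variables (R : realType) (n : nat).
Implicit Types u v w : 'rV[R]_n.

Definition dot u v : R := \sum_(j < n) u 0 j * v 0 j.

Lemma dotBl u v w : dot (u - v) w = dot u w - dot v w.
Proof. by rewrite -sumrB; apply: eq_bigr => j _; rewrite !mxE mulrBl. Qed.

Lemma dotZl a u v : dot (a *: u) v = a * dot u v.
Proof. by rewrite mulr_sumr; apply: eq_bigr => j _; rewrite mxE mulrA. Qed.

Lemma enorm_ge0 u : 0 <= enorm u.
Proof. exact: sqrtr_ge0. Qed.

Lemma sqr_enorm u : enorm u ^+ 2 = \sum_(j < n) u 0 j ^+ 2.
Proof. by rewrite sqr_sqrtr// sumr_ge0// => j _; exact: sqr_ge0. Qed.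

Lemma enormN u : enorm (- u) = enorm u.
Proof. by congr Num.sqrt; apply: eq_bigr => j _; rewrite mxE sqrrN. Qed.

Lemma enormZ a u : enorm (a *: u) = `|a| * enorm u.
Proof.
rewrite /enorm -sqrtr_sqr -sqrtrM ?sqr_ge0//; congr Num.sqrt.
by rewrite mulr_sumr; apply: eq_bigr => j _; rewrite mxE exprMn.
Qed.

Lemma coord_le_enorm u j : `|u 0 j| <= enorm u.
Proof.
rewrite -ler_sqr ?nnegrE ?enorm_ge0// sqr_enorm real_normK ?num_real//.
by rewrite (bigD1 j)//= lerDl sumr_ge0// => k _; exact: sqr_ge0.
Qed.

Lemma enorm_eq0 u : enorm u = 0 -> u = 0.
Proof.
move=> u0; apply/rowP => j; rewrite mxE.
by apply/eqP; rewrite -normr_le0 -u0 coord_le_enorm.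
Qed.

(** Estimated coordinate by coordinate, without Cauchy-Schwarz. The constant [n * d] is cruder than
    necessary, but it also serves in [sqr_enorm_le], so a single bound [b = r * delta] controls all
    increments. *)
Lemma dot_le_enorm u v d : 0 <= d -> (forall j, `|v 0 j| <= d) ->
  `|dot u v| <= n%:R * d * enorm u.
Proof.
move=> d0 vd; apply: le_trans (ler_norm_sum _ _ _) _.
rewrite -mulrA mulr_natl -[X in _ *+ X]card_ord -sumr_const.
apply: ler_sum => j _; rewrite normrM mulrC.
by apply: ler_pM => //; exact: coord_le_enorm.
Qed.

Lemma sqr_enorm_le v d : 0 <= d -> (forall j, `|v 0 j| <= d) ->
  enorm v ^+ 2 <= (n%:R * d) ^+ 2.
Proof.
move=> d0 vd; rewrite sqr_enorm exprMn.
apply: (@le_trans _ _ (n%:R * d ^+ 2)).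
  rewrite mulr_natl -[X in _ *+ X]card_ord -sumr_const; apply: ler_sum => j _.
  by rewrite -real_normK ?num_real// lerXn2r ?nnegrE.
apply: ler_wpM2r; first exact: sqr_ge0.
by rewrite -natrX ler_nat; case: (n) => // m; rewrite expnS expn1 leq_pmulr.
Qed.

Lemma sqr_enormD u v :
  enorm (u + v) ^+ 2 = enorm u ^+ 2 + 2 * dot u v + enorm v ^+ 2.
Proof.
rewrite !sqr_enorm mulr_sumr -!big_split; apply: eq_bigr => j _ /=.
by rewrite mxE; ring.
Qed.

End euclidean.

(** [expR (- x) >= 1 - x] gives [expR x <= (1 - x)^-1], and [(1 - x) * (1 + x + 2 * x ^+ 2) = 1 + x
    ^+ 2 * (1 - 2 * x)] is at least 1 for [x <= 2^-1]. No lower bound on [x] is imposed. *)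
Lemma expR_le_quad (R : realType) (x : R) :
  x <= 2^-1 -> expR x <= 1 + x + 2 * x ^+ 2.
Proof.
move=> xh.
have x1 : 0 < 1 - x by lra.
have : expR x <= (1 - x)^-1.
  rewrite -[expR x]invrK lef_pV2 ?posrE// -?expRN ?expR_gt0//.
  by apply: le_trans (expR_ge1Dx _); lra.
move/le_trans; apply.
rewrite -(ler_pM2r x1) mulVf ?gt_eqF//.
have := sqr_ge0 x; nra.
Qed.

(** * Lipschitz bound, scaling in [V], sensitivity to the state law, and weak duality *)

Section network_duality.
Variables (R : realType) (r M : nat) (T : topologicalType).
Variables (net : network R r M T) (p : 'rV[R]_M) (delta : R).
Hypothesis hnet : network_axioms net delta.
Hypothesis act0 : forall i, actions net i !=set0.
Hypothesis hp : distribution_vec p.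

Definition drift i (x : T) : 'rV[R]_r := arrival net i x - service net i x.

Definition lagr (V : R) i (x : T) (gamma : 'rV[R]_r) : R :=
  V * cost net i x + dot gamma (drift i x).

Lemma cost_bound i x : actions net i x -> `|cost net i x| <= delta.
Proof. by case: hnet => _ _ h _ _; exact: h. Qed.

Lemma drift_bound i x : actions net i x -> forall j, `|drift i x 0 j| <= delta.
Proof.
case: hnet => _ _ _ hA hS ax j; rewrite !mxE.
have /andP[A0 Ad] := hA _ _ j ax; have /andP[S0 Sd] := hS _ _ j ax.
by rewrite ler_norml; apply/andP; split; lra.
Qed.

Lemma dot_drift_bound i x u : actions net i x ->
  `|dot u (drift i x)| <= r%:R * delta * enorm u.
Proof.
move=> ax; apply: dot_le_enorm; last exact: drift_bound.
exact: le_trans (normr_ge0 _) (cost_bound ax).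
Qed.

Lemma state_dualE V i gamma : state_dual net V i gamma =
  inf [set lagr V i x gamma | x in actions net i].
Proof.
rewrite /state_dual; congr inf; apply: eq_imagel => x _; congr (_ + _).
by apply: eq_bigr => j _; rewrite !mxE.
Qed.

Lemma has_inf_lagr V i gamma :
  has_inf [set lagr V i x gamma | x in actions net i].
Proof.
split; first by have [x ax] := act0 i; exists (lagr V i x gamma), x.
exists (- (`|V| * delta + r%:R * delta * enorm gamma)) => _ [x ax <-].
have := dot_drift_bound gamma ax; rewrite ler_norml => /andP[h _].
have : `|V * cost net i x| <= `|V| * delta.
  by rewrite normrM ler_wpM2l// cost_bound.
by rewrite ler_norml => /andP[h' _]; rewrite /lagr opprD lerD.
Qed.

Lemma state_dual_le V i x gamma : actions net i x ->
  state_dual net V i gamma <= lagr V i x gamma.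
Proof.
move=> ax; rewrite state_dualE; apply: ge_inf; last by exists x.
by case: (has_inf_lagr V i gamma).
Qed.

Lemma le_state_dual V i gamma c :
  (forall x, actions net i x -> c <= lagr V i x gamma) ->
  c <= state_dual net V i gamma.
Proof.
move=> hc; rewrite state_dualE; apply: lb_le_inf.
  by case: (has_inf_lagr V i gamma).
by move=> _ [x ax <-]; exact: hc.
Qed.

(** An infimum of affine functions of [g] whose gradients are bounded drift vectors. The constant
    does not involve [V]. *)
Lemma state_dual_lip V i g g' :
  `|state_dual net V i g - state_dual net V i g'|
    <= r%:R * delta * enorm (g - g').
Proof.
have half h h' : state_dual net V i h - state_dual net V i h'
    <= r%:R * delta * enorm (h - h').
  rewrite lerBlDr -lerBlDl; apply: le_state_dual => x ax; rewrite lerBlDl.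
  apply: le_trans (state_dual_le _ _ ax) _.
  have := le_trans (ler_norm _) (dot_drift_bound (h - h') ax).
  by rewrite dotBl /lagr; lra.
rewrite ler_norml half andbT lerNl opprB.
by rewrite -(enormN (g - g')) opprB half.
Qed.

Lemma state_dual_scale V i g : 0 < V ->
  state_dual net V i (V *: g) = V * state_dual net 1 i g.
Proof.
move=> V0; apply/eqP; rewrite eq_le; apply/andP; split.
  rewrite -ler_pdivrMl//; apply: le_state_dual => x ax.
  rewrite ler_pdivrMl//; apply: le_trans (state_dual_le _ _ ax) _.
  by rewrite /lagr dotZl mul1r mulrDr.
apply: le_state_dual => x ax; rewrite /lagr dotZl -mulrDr ler_pM2l//.
by apply: le_trans (state_dual_le _ _ ax) _; rewrite /lagr mul1r.
Qed.

Lemma dual_scale (q : 'rV[R]_M) V g : 0 < V -> dual net q V (V *: g) = V * dual net q 1 g.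
Proof.
move=> V0; rewrite /dual mulr_sumr; apply: eq_bigr => i _.
by rewrite state_dual_scale// mulrCA.
Qed.

(** The Lagrangian is homogeneous in [V] and the multiplier jointly, and so is the norm. The slope
    [rho] is therefore the same for every [V], which makes all later drift constants uniform in
    [V]. *)
Lemma polyhedral_scale gamma0 (rho V : R) (g : 'rV[R]_r) :
  0 < V -> polyhedral net p gamma0 rho ->
  dual net p V g + rho * enorm (g - V *: gamma0) <= dual net p V (V *: gamma0).
Proof.
move=> V0 poly; have -> : g = V *: (V^-1 *: g).
  by rewrite scalerA divff ?gt_eqF// scale1r.
rewrite !dual_scale// -scalerBr enormZ gtr0_norm// mulrCA -mulrDr ler_pM2l//.
by rewrite -(enormN (_ - gamma0)) opprB; exact: poly.
Qed.

Lemma dual_near_le (q : 'rV[R]_M) (V : R) g g' (eps : R) :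
  (forall i, `|q 0 i - p 0 i| <= eps) ->
  dual net q V g - dual net q V g' <=
  dual net p V g - dual net p V g' + M%:R * eps * (r%:R * delta) * enorm (g - g').
Proof.
move=> qp; rewrite -lerBlDl.
have -> : dual net q V g - dual net q V g' - (dual net p V g - dual net p V g')
    = \sum_(i < M) (q 0 i - p 0 i) * (state_dual net V i g - state_dual net V i g').
  by rewrite /dual -!sumrB; apply: eq_bigr => i _; ring.
rewrite -!mulrA mulr_natl -[X in _ *+ X]card_ord -sumr_const.
apply: ler_sum => i _; apply: le_trans (ler_norm _) _; rewrite normrM.
by apply: ler_pM => //; rewrite mulrA state_dual_lip.
Qed.

(* Polyhedrality beats the Lipschitz perturbation: the empirical maximizer is
   not merely close to the true one but equal to it. *)
Lemma dual_solution_near gamma0 (rho V : R) (q : 'rV[R]_M) (eps : R) b :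
  0 < V -> nonneg_vec gamma0 -> polyhedral net p gamma0 rho ->
  (forall i, `|q 0 i - p 0 i| <= eps) -> M%:R * eps * (r%:R * delta) < rho ->
  ((exists g, dual_solution net q V g) -> dual_solution net q V b) ->
  b = V *: gamma0.
Proof.
move=> V0 g0 poly qp small sol.
(* Under [q] the point [V *: gamma0] stays a sharp maximum, with a slope that is reduced but still
   positive. *)
have key g : dual net q V g + (rho - M%:R * eps * (r%:R * delta))
    * enorm (g - V *: gamma0) <= dual net q V (V *: gamma0).
  have := dual_near_le V g (V *: gamma0) qp.
  by have := polyhedral_scale g V0 poly; rewrite mulrBl; lra.
(* This proves that the perturbed problem is solvable, so that [sol] makes [b] a solution. *)
have gs : dual_solution net q V (V *: gamma0).
  split=> [j|g _]; first by rewrite mxE mulr_ge0// ltW.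
  apply: le_trans (key g); rewrite lerDl mulr_ge0 ?enorm_ge0// subr_ge0.
  exact: ltW.
have [_ bmax] := sol (ex_intro _ _ gs).
have := le_trans (key b) (bmax _ (proj1 gs)).
rewrite gerDl pmulr_rle0 ?subr_gt0// => h; apply/eqP; rewrite -subr_eq0.
by apply/eqP/enorm_eq0/eqP; rewrite eq_le h enorm_ge0.
Qed.

Lemma weighted_series_cvg (w h : nat -> R) d : (forall k, 0 <= w k) ->
  cvgn (series w) -> (forall k, `|h k| <= d) ->
  cvgn (series (fun k => w k * h k)).
Proof.
move=> w0 cw hd; apply: normed_cvg.
apply: (@series_le_cvg _ _ (fun k => d * w k)) => [k|k|k|].
- exact: normr_ge0.
- by rewrite mulr_ge0// (le_trans (normr_ge0 _) (hd k)).
- by rewrite /= normrM ger0_norm// mulrC ler_wpM2r.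
- exact: is_cvg_seriesZ.
Qed.

Lemma weak_duality (x : 'I_M -> nat -> T) w V g : mixture net x w ->
  dual net p V g <= V * mixture_mean p x w (cost net)
    + \sum_(j < r) g 0 j * mixture_mean p x w
        (fun i y => arrival net i y 0 j - service net i y 0 j).
Proof.
move=> mix.
set F := fun i => limn (series (fun k => w i k * cost net i (x i k))).
set D := fun i j => limn (series (fun k => w i k
  * (arrival net i (x i k) 0 j - service net i (x i k) 0 j))).
have -> : V * mixture_mean p x w (cost net)
    + \sum_(j < r) g 0 j * mixture_mean p x w
        (fun i y => arrival net i y 0 j - service net i y 0 j)
    = \sum_(i < M) p 0 i * (V * F i + \sum_(j < r) g 0 j * D i j).
  rewrite /mixture_mean mulr_sumr.
  under [X in _ + X]eq_bigr do rewrite mulr_sumr.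
  rewrite exchange_big -big_split; apply: eq_bigr => i _ /=.
  by rewrite mulrDr mulrCA mulr_sumr; congr (_ + _); apply: eq_bigr => j _;
    rewrite mulrCA.
apply: ler_sum => i _; apply: ler_wpM2l; first by case: hp.
have [ax w0 w1] := mix i.
have cF : cvgn (series (fun k => w i k * cost net i (x i k))).
  apply: (@weighted_series_cvg _ _ delta) => //; first by apply/cvg_ex; exists 1.
  by move=> k; exact: cost_bound.
have cD j : cvgn (series (fun k => w i k
    * (arrival net i (x i k) 0 j - service net i (x i k) 0 j))).
  apply: (@weighted_series_cvg _ _ delta) => //; first by apply/cvg_ex; exists 1.
  by move=> k; have := drift_bound (ax k) j; rewrite !mxE.
(* The factor 1 is read as the limit of the partial sums of the weights, so that the comparison can
   be made term by term before the limit. *)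
have -> : state_dual net V i g = state_dual net V i g * 1 by rewrite mulr1.
apply: (@ler_cvg_to _ \oo _ _ (fun n => state_dual net V i g * series (w i) n)
  (fun n => V * series (fun k => w i k * cost net i (x i k)) n
    + \sum_(j < r) g 0 j * series (fun k => w i k
    * (arrival net i (x i k) 0 j - service net i (x i k) 0 j)) n)).
- exact: cvgMl_tmp.
- apply: cvgD; first exact: cvgMl_tmp.
  by apply: cvg_big; [exact: add_continuous | move=> j _; apply: cvgMl_tmp; exact: cD].
apply: nearW => n; rewrite /series /= !mulr_sumr.
under [X in _ + X]eq_bigr do rewrite mulr_sumr.
rewrite exchange_big -big_split; apply: ler_sum => k _ /=.
rewrite mulrC; apply: le_trans (ler_wpM2l (w0 k) (state_dual_le V g (ax k))) _.
rewrite /lagr /dot mulrDr mulrCA mulr_sumr lerD2l.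
by apply: ler_sum => j _; rewrite !mxE mulrCA.
Qed.

End network_duality.

(** * Scalar estimates *)

Lemma time_average_le (R : realType) (a : nat -> R) (c s : R) :
  (forall t, \sum_(tau < t) a tau <= t%:R * c + s) ->
  (time_average (fun t => (a t)%:E) <= c%:E)%E.
Proof.
move=> ha; apply/lee_addgt0Pr => e e0.
have [N Ns] : exists N, `|s| / e < N%:R.
  by exists (Num.truncn (`|s| / e)).+1; exact: truncnS_gt.
(* The upper limit is an infimum over neighbourhoods of infinity; on the tail beyond [N] the
   constant [s] contributes at most [e] after division by [t]. *)
apply: ereal_inf_le; eexists.
  by exists [set t | (N < t)%N]; [exists N.+1 | reflexivity].
apply: ge_ereal_sup => _ [t /= Nt <-].
have t0 : 0 < t%:R :> R by rewrite ltr0n (leq_ltn_trans _ Nt).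
rewrite sumEFin -EFinM -EFinD lee_fin ler_pdivrMl//.
apply: le_trans (ha t) _; rewrite mulrDr lerD2l.
have : `|s| / e <= t%:R by rewrite (le_trans (ltW Ns))// ler_nat ltnW.
by rewrite ler_pdivrMr// mulrC; exact: le_trans (ler_norm s).
Qed.

Lemma sum_expR_geometric_le (R : realType) (k : R) t : 0 < k ->
  \sum_(tau < t) expR (- k * tau%:R) <= (1 - expR (- k))^-1.
Proof.
move=> k0; set z := expR (- k).
have z1 : 0 < 1 - z by rewrite subr_gt0 expR_lt1 oppr_lt0.
rewrite (eq_bigr (fun tau : 'I_t => z ^+ tau)); last first.
  by move=> tau _; rewrite -expRM_natr.
rewrite -(ler_pM2l z1) mulfV ?gt_eqF// -[X in X * _]opprB mulNr -subrX1 opprB.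
by rewrite gerBl exprn_ge0// expR_ge0.
Qed.

(* [s] stands for the inner product of the displacement [z], of norm [Y], with
   the increment of the queues; expanding [expR (K * (Y' - Y))] to second order
   around [s / Y] leaves an error of at most [K * rho / 2]. *)
Lemma expR_norm_step (R : realType) (Y Y' s b rho K : R) :
  0 <= Y' -> 0 < b -> 0 < rho -> 0 < K ->
  4 * K * b <= 1 -> 32 * K * b ^+ 2 <= rho ->
  b + 2 * b ^+ 2 / rho <= Y -> `|s| <= b * Y ->
  Y' ^+ 2 <= Y ^+ 2 + 2 * s + b ^+ 2 ->
  expR (K * Y') <= expR (K * Y) * (1 + K * (s / Y) + K * rho / 2).
Proof.
move=> Y'0 b0 rho0 K0 K4 K32 Yb sY Y'Y.
have c0 : 0 <= 2 * b ^+ 2 / rho by rewrite divr_ge0 ?mulr_ge0 ?sqr_ge0 ?ltW.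
have Y0 : 0 < Y by lra.
(* [E] is chosen with [2 * E * Y = b ^+ 2], so that completing the square gives [Y' <= Y + (D + E)].
   In the lower bound on [Y], the term [2 * b ^+ 2 / rho] forces [E <= rho / 4], and the term [b]
   keeps [Y + (D + E)] nonnegative. *)
pose D := s / Y; pose E := b ^+ 2 / (2 * Y).
have sE : s = D * Y by rewrite /D divfK// gt_eqF.
have bE : b ^+ 2 = 2 * E * Y by rewrite /E; field; rewrite gt_eqF.
have E0 : 0 <= E by rewrite divr_ge0 ?sqr_ge0// mulr_ge0// ltW.
have Db : `|D| <= b by rewrite normrM normfV (gtr0_norm Y0) ler_pdivrMr.
have Er : E <= rho / 4.
  rewrite /E ler_pdivrMr ?mulr_gt0//.
  have : rho * (2 * b ^+ 2 / rho) <= rho * Y by rewrite ler_pM2l//; lra.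
  by rewrite mulrC divfK ?gt_eqF//; lra.
have Eb : E <= b / 2.
  rewrite /E ler_pdivrMr ?mulr_gt0//.
  have : b * b <= b * Y by rewrite ler_pM2l//; lra.
  by rewrite expr2; lra.
move: Db; rewrite ler_norml => /andP[Dl Du].
have Y'le : Y' <= Y + (D + E).
  rewrite -ler_sqr ?nnegrE//; last by lra.
  by have := sqr_ge0 (D + E); rewrite sE bE in Y'Y; nra.
have KD : K * (D + E) <= 2^-1.
  have : K * (D + E) <= K * (2 * b) by rewrite ler_pM2l//; lra.
  by lra.
have sq : (D + E) ^+ 2 <= 4 * b ^+ 2 by nra.
apply: (@le_trans _ _ (expR (K * Y) * expR (K * (D + E)))).
  by rewrite -expRD ler_expR -mulrDr ler_pM2l.
rewrite ler_pM2l ?expR_gt0//; apply: le_trans (expR_le_quad KD) _.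
have h1 : 2 * (K * (D + E)) ^+ 2 <= K * (rho / 4).
  rewrite exprMn expr2.
  have -> : 2 * (K * K * (D + E) ^+ 2) = K * (2 * K * (D + E) ^+ 2) by ring.
  rewrite ler_pM2l//.
  have : 2 * K * (D + E) ^+ 2 <= 2 * K * (4 * b ^+ 2).
    by rewrite ler_pM2l ?mulr_gt0.
  by lra.
have h2 : K * E <= K * (rho / 4) by rewrite ler_pM2l.
by rewrite -/D mulrDr; lra.
Qed.

Lemma le_expR_div (R : realType) (K y : R) : 0 < K -> y <= expR (K * y) / K.
Proof.
move=> K0; rewrite ler_pdivlMr// mulrC.
by apply: le_trans (expR_ge1Dx _); rewrite lerDr.
Qed.

Lemma sqr_le_expR (R : realType) (K y : R) : 0 < K -> 0 <= y ->
  y ^+ 2 / 2 <= expR (K * y) / K ^+ 2.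
Proof.
move=> K0 y0; rewrite ler_pdivlMr ?exprn_gt0//.
have := @expR_ge1Dxn _ (K * y) 1 (mulr_ge0 (ltW K0) y0).
rewrite !exprMn (_ : 2`!%:R = 2)//; lra.
Qed.

(** * Expectations of bounded random variables and sub-sigma-algebras *)

Section bounded_expectation.
Context d (Omega : measurableType d) (R : realType) (P : probability Omega R).
Implicit Types X Y : Omega -> R.

(** An algebra of integrable functions. It suffices here because the queues grow by a bounded amount
    per slot, so the quantities averaged at a fixed slot are bounded. *)
Definition bmeas X : Prop :=
  measurable_fun setT X /\ exists c : R, forall w, `|X w| <= c.

Definition mean X : R := \int[P]_w X w.

Lemma bmeas_cst c : bmeas (fun=> c).
Proof. by split; [exact: measurable_cst | exists `|c|]. Qed.

Lemma bmeasD X Y : bmeas X -> bmeas Y -> bmeas (fun w => X w + Y w).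
Proof.
move=> [mX [a Xa]] [mY [b Yb]]; split; first exact: measurable_funD.
by exists (a + b) => w; apply: le_trans (ler_normD _ _) _; exact: lerD.
Qed.

Lemma bmeasM X Y : bmeas X -> bmeas Y -> bmeas (fun w => X w * Y w).
Proof.
move=> [mX [a Xa]] [mY [b Yb]]; split; first exact: measurable_funM.
by exists (a * b) => w; rewrite normrM ler_pM.
Qed.

Lemma bmeasZ c X : bmeas X -> bmeas (fun w => c * X w).
Proof. by apply: bmeasM; exact: bmeas_cst. Qed.

Lemma bmeasB X Y : bmeas X -> bmeas Y -> bmeas (fun w => X w - Y w).
Proof.
move=> bX bY; rewrite (_ : (fun w => _) = (fun w => X w + -1 * Y w)).
  by apply: bmeasD => //; exact: bmeasZ.
by apply/funext => w; rewrite mulN1r.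
Qed.

Lemma bmeas_sum (I : Type) (s : seq I) (F : I -> Omega -> R) :
  (forall i, bmeas (F i)) -> bmeas (fun w => \sum_(i <- s) F i w).
Proof.
move=> bF; elim: s => [|i s IHs].
  by under eq_fun do rewrite big_nil; exact: bmeas_cst.
by under eq_fun do rewrite big_cons; exact: bmeasD.
Qed.

Lemma bmeas_eq (I : eqType) (S : Omega -> I) i :
  measurable [set w | S w = i] -> bmeas (fun w => (S w == i)%:R).
Proof.
move=> mD; split; last by exists 1 => w; case: eqP; rewrite ?normr0 ?normr1 ?ler01.
rewrite (_ : (fun w => _) = \1_[set w | S w = i]); first exact: measurable_indic.
apply/funext => w; rewrite indicE; congr ((nat_of_bool _)%:R).
by apply/idP/idP => [/eqP Sw|/set_mem/= ->] //; exact/mem_set.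
Qed.

Lemma bmeas_integrable X : bmeas X -> P.-integrable setT (EFin \o X).
Proof.
move=> [mX [c Xc]]; apply: measurable_bounded_integrable => //.
  by rewrite (le_lt_trans (probability_le1 P measurableT))// ltry.
exists c; split; first exact: num_real.
by move=> e ce w _; exact: le_trans (Xc w) (ltW ce).
Qed.

Lemma expectationE X : bmeas X -> 'E_P[X]%E = (mean X)%:E.
Proof.
move=> bX; rewrite unlock /mean /Rintegral fineK//.
exact: (integrable_fin_num measurableT (bmeas_integrable bX)).
Qed.

Lemma mean_cst c : mean (fun=> c) = c.
Proof. by rewrite /mean Rintegral_cst//= probability_setT mulr1. Qed.

Lemma meanD X Y : bmeas X -> bmeas Y -> mean (fun w => X w + Y w) = mean X + mean Y.
Proof. by move=> bX bY; apply: RintegralD => //; exact: bmeas_integrable. Qed.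

Lemma meanZ c X : bmeas X -> mean (fun w => c * X w) = c * mean X.
Proof. by move=> bX; apply: RintegralZl => //; exact: bmeas_integrable. Qed.

Lemma meanB X Y : bmeas X -> bmeas Y -> mean (fun w => X w - Y w) = mean X - mean Y.
Proof. by move=> bX bY; apply: RintegralB => //; exact: bmeas_integrable. Qed.

Lemma mean_le X Y : bmeas X -> bmeas Y -> (forall w, X w <= Y w) -> mean X <= mean Y.
Proof.
by move=> bX bY XY; apply: le_Rintegral => //; exact: bmeas_integrable.
Qed.

Lemma mean_ge0 X : (forall w, 0 <= X w) -> 0 <= mean X.
Proof. by move=> X0; apply: Rintegral_ge0. Qed.

Lemma mean_sum (I : Type) (s : seq I) (F : I -> Omega -> R) :
  (forall i, bmeas (F i)) ->
  mean (fun w => \sum_(i <- s) F i w) = \sum_(i <- s) mean (F i).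
Proof.
move=> bF; elim: s => [|i s IHs].
  by under eq_fun do rewrite big_nil; rewrite mean_cst big_nil.
under eq_fun do rewrite big_cons; rewrite meanD ?IHs ?big_cons//.
exact: bmeas_sum.
Qed.

(** * Adapted functions and independence of a sub-sigma-algebra *)

Section sub_sigma_algebra.
Variable G : set (set Omega).
Hypothesis sG : sigma_algebra setT G.

Lemma sigma_measurableE (A : set (g_sigma_algebraType G)) : measurable A = G A.
Proof. by rewrite /measurable /= sigma_algebra_id. Qed.

(** A sigma-algebra generates itself, so closure properties of adaptedness are inherited from those
    of measurable functions on the generated type. *)
Lemma adaptedP X :
  adapted_to G X <-> measurable_fun [set: g_sigma_algebraType G] X.
Proof.
split=> [aX _ B mB|mX B mB]; first by rewrite setTI sigma_measurableE; exact: aX.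
by rewrite -sigma_measurableE -[X in measurable X]setTI; exact: mX.
Qed.

Lemma adapted_comp (f : R -> R) X : measurable_fun setT f ->
  adapted_to G X -> adapted_to G (f \o X).
Proof. by move=> mf /adaptedP mX; apply/adaptedP; exact: measurableT_comp. Qed.

Lemma adapted_cst c : adapted_to G (fun=> c : R).
Proof. by apply/adaptedP; exact: measurable_cst. Qed.

Lemma adaptedD X Y : adapted_to G X -> adapted_to G Y ->
  adapted_to G (fun w => X w + Y w).
Proof.
by move=> /adaptedP mX /adaptedP mY; apply/adaptedP; exact: measurable_funD.
Qed.

Lemma adaptedB X Y : adapted_to G X -> adapted_to G Y ->
  adapted_to G (fun w => X w - Y w).
Proof.
by move=> /adaptedP mX /adaptedP mY; apply/adaptedP; exact: measurable_funB.
Qed.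

Lemma adaptedM X Y : adapted_to G X -> adapted_to G Y ->
  adapted_to G (fun w => X w * Y w).
Proof.
by move=> /adaptedP mX /adaptedP mY; apply/adaptedP; exact: measurable_funM.
Qed.

Lemma adapted_max X Y : adapted_to G X -> adapted_to G Y ->
  adapted_to G (fun w => Num.max (X w) (Y w)).
Proof.
by move=> /adaptedP mX /adaptedP mY; apply/adaptedP; exact: measurable_maxr.
Qed.

Lemma adapted_sum (I : Type) (s : seq I) (F : I -> Omega -> R) :
  (forall i, adapted_to G (F i)) -> adapted_to G (fun w => \sum_(i <- s) F i w).
Proof.
move=> aF; elim: s => [|i s IHs].
  by under eq_fun do rewrite big_nil; exact: adapted_cst.
by under eq_fun do rewrite big_cons; exact: adaptedD.
Qed.

Lemma adapted_bool (b : Omega -> bool) :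
  G [set w | b w] -> adapted_to G (fun w => (b w)%:R : R).
Proof.
rewrite -sigma_measurableE => mb; apply/adaptedP.
rewrite (_ : (fun w => _) = \1_[set w | b w]); first exact: measurable_indic.
by apply/funext => w; rewrite indicE; congr (_%:R); rewrite mem_setE.
Qed.

Lemma sigma_forall (I : finType) (F : I -> set Omega) :
  (forall i, G (F i)) -> G [set w | forall i, F i w].
Proof.
move=> GF; rewrite -sigma_measurableE.
have -> : [set w | forall i, F i w] = \bigcap_(i in [set: I]) F i.
  by apply/seteqP; split => [w Fw i _|w Fw i]; exact: Fw.
apply: fin_bigcap_measurable; first exact: finite_finset.
by move=> i _; rewrite sigma_measurableE.
Qed.

(** With countable range, every preimage is a countable union of level sets of [Q]; this is why [F]
    may be arbitrary. *)
Lemma adapted_countable (T : Type) (Q : Omega -> T) (D : set T) (F : T -> R) :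
  countable D -> (forall w, D (Q w)) -> (forall v, D v -> G [set w | Q w = v]) ->
  adapted_to G (F \o Q).
Proof.
move=> cD DQ GQ B mB.
have /countable_injP[f finj] := cD.
(* Injectivity of [f] on [D] makes each piece either empty or exactly one level set of [Q]. *)
pose A n := [set w | B (F (Q w)) /\ f (Q w) = n].
have -> : (F \o Q) @^-1` B = \bigcup_n A n.
  by apply/seteqP; split => [w Bw|w [n _ [Bw _]]] //; exists (f (Q w)).
have GA n : G (A n).
  have [[v [Dv Bv fv]]|nv] := pselect (exists v, [/\ D v, B (F v) & f v = n]).
    rewrite (_ : A n = [set w | Q w = v]); first exact: GQ.
    apply/seteqP; split => [w [_ fQ]|w /= Qv]; last by rewrite /A /= Qv.
    by apply: finj; rewrite ?inE ?fv ?fQ.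
  rewrite (_ : A n = set0) -?sigma_measurableE//; apply/seteqP; split => // w [Bw fw].
  by apply: nv; exists (Q w).
rewrite -sigma_measurableE; apply: bigcup_measurable => n _.
by rewrite sigma_measurableE.
Qed.

Hypothesis Gm : G `<=` measurable.

Lemma adapted_measurable X : adapted_to G X -> measurable_fun setT X.
Proof. by move=> aX _ B mB; rewrite setTI; apply: Gm; exact: aX. Qed.

Lemma adapted_bmeas X (c : R) : adapted_to G X -> (forall w, `|X w| <= c) -> bmeas X.
Proof. by move=> aX Xc; split; [exact: adapted_measurable | exists c]. Qed.

(** Layer-cake formula: both means are integrals of tail probabilities over [y >= 0]. For such [y]
    the product exceeds [y] exactly on the part of [X > y] where [S = i], and the probability of
    this event factors. *)
Lemma mean_indep_ge0 X (c : R) (I : eqType) (S : Omega -> I) (i : I) (q : R) :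
  adapted_to G X -> (forall w, 0 <= X w <= c) -> 0 <= q ->
  measurable [set w | S w = i] ->
  (forall B, G B -> P (B `&` [set w | S w = i]) = (P B * q%:E)%E) ->
  mean (fun w => (S w == i)%:R * X w) = q * mean X.
Proof.
move=> aX X0c q0 mD PD; set D := [set w | S w = i] in mD PD.
have mX := adapted_measurable aX.
have bX : bmeas X.
  apply: (@adapted_bmeas _ c) => // w.
  by have /andP[X0 Xc] := X0c w; rewrite ger0_norm.
pose Z w := (S w == i)%:R * X w.
have bD := bmeas_eq mD.
have bZ : bmeas Z by exact: bmeasM.
pose rX : {RV P >-> R} := HB.pack X (isMeasurableFun.Build _ _ _ _ X mX).
pose rZ : {RV P >-> R} := HB.pack Z (isMeasurableFun.Build _ _ _ _ Z bZ.1).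
apply: EFin_inj; rewrite EFinM -!expectationE//.
rewrite (ge0_expectation_ccdf (X := rX)); last by move=> w; case/andP: (X0c w).
rewrite (ge0_expectation_ccdf (X := rZ)); last first.
  by move=> w; rewrite mulr_ge0//; case/andP: (X0c w).
rewrite -ge0_integralZl//; last exact: measurable_funTS (ccdf_measurable _).
apply: eq_integral => y; rewrite inE /= in_itv /= andbT => y0.
rewrite /ccdf /distribution /pushforward /= muleC -PD; last exact: aX.
congr (P _); apply/seteqP; split => [w /=|w /= [Xw Sw]].
  rewrite /Z !in_itv /= !andbT; have [Sw|_] := eqVneq (S w) i.
    by rewrite mul1r.
  by rewrite mul0r ltNge y0.
by rewrite /Z Sw eqxx mul1r.
Qed.

Lemma mean_indep X (c : R) (I : eqType) (S : Omega -> I) (i : I) (q : R) :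
  adapted_to G X -> (forall w, `|X w| <= c) -> 0 <= q ->
  measurable [set w | S w = i] ->
  (forall B, G B -> P (B `&` [set w | S w = i]) = (P B * q%:E)%E) ->
  mean (fun w => (S w == i)%:R * X w) = q * mean X.
Proof.
move=> aX Xc q0 mD PD.
have bX := adapted_bmeas aX Xc.
(* Shifting by [c] reduces to nonnegative variables; the constant is subtracted at the end. *)
have ac : adapted_to G (fun w => X w + c) by exact/adaptedD/adapted_cst.
have Xc0 w : 0 <= X w + c <= c + c.
  by have := Xc w; rewrite ler_norml => /andP[? ?]; apply/andP; split; lra.
have c0 (w : Omega) : 0 <= c <= c by rewrite lexx (le_trans (normr_ge0 _) (Xc w)).
have E1 := mean_indep_ge0 ac Xc0 q0 mD PD.
have E2 := mean_indep_ge0 (adapted_cst c) c0 q0 mD PD.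
have bD := bmeas_eq mD.
rewrite (_ : (fun w => _) = fun w => (S w == i)%:R * (X w + c) - (S w == i)%:R * c).
  rewrite meanB ?E1 ?E2 ?meanD ?mean_cst//; [by ring|exact: bmeas_cst| | ].
  - by apply: bmeasM => //; apply: bmeasD => //; exact: bmeas_cst.
  - by apply: bmeasM => //; exact: bmeas_cst.
by apply/funext => w; ring.
Qed.

End sub_sigma_algebra.
End bounded_expectation.

(** * The state process *)

Section state_process.
Variables (R : realType) (r M : nat) (T : topologicalType).
Variables (net : network R r M T) (p : 'rV[R]_M).
Hypothesis hp : distribution_vec p.
Context d (Omega : measurableType d) (P : probability Omega R).
Variable u : controlled_process M T Omega.
Hypothesis hf : feasible net p P u.

Lemma info_sigma t : sigma_algebra setT (info u t).
Proof. by case: hf => h _ _ _ _; case: (h t). Qed.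

Lemma info_measurable t : info u t `<=` measurable.
Proof. by case: hf => h _ _ _ _; case: (h t). Qed.

Lemma info_le s t : (s <= t)%N -> info u s `<=` info u t.
Proof.
case: hf => _ h _ _ _; elim: t => [|t IHt]; first by rewrite leqn0 => /eqP ->.
rewrite leq_eqVlt => /predU1P[->//|st].
exact: subset_trans (IHt st) (h t).
Qed.

Lemma adapted_le s t (X : Omega -> R) : (s <= t)%N ->
  adapted_to (info u s) X -> adapted_to (info u t) X.
Proof. by move=> st aX B mB; apply: (info_le st); exact: aX. Qed.

Lemma state_info s t i : (s < t)%N -> info u t [set w | state u s w = i].
Proof. by move=> st; apply: (info_le st); case: hf => _ _ h _ _; exact: h. Qed.

Lemma adapted_state s t (c : 'I_M -> R) : (s < t)%N ->
  adapted_to (info u t) (fun w => c (state u s w)).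
Proof.
move=> st; apply: (adapted_countable (info_sigma t) (D := setT)) => //.
by move=> v _; exact: state_info.
Qed.

Lemma sum_state t (F : 'I_M -> R) w :
  \sum_(i < M) (state u t w == i)%:R * F i = F (state u t w).
Proof.
rewrite (bigD1 (state u t w))//= eqxx mul1r big1 ?addr0// => i.
by rewrite eq_sym => /negbTE ->; rewrite mul0r.
Qed.

(** Splitting over the values of [S(t)] and using its independence of the past replaces the current
    state by its average under [p], as a conditional expectation would. *)
Lemma mean_state t (F : 'I_M -> Omega -> R) (c : R) :
  (forall i, adapted_to (info u t) (F i)) -> (forall i w, `|F i w| <= c) ->
  bmeas (fun w => F (state u t w) w) /\
  mean P (fun w => F (state u t w) w) = mean P (fun w => \sum_(i < M) p 0 i * F i w).
Proof.
move=> aF Fc.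
have bF i : bmeas (F i).
  exact: (adapted_bmeas (@info_measurable t) (aF i) (Fc i)).
have mS i : measurable [set w | state u t w = i].
  by apply: (@info_measurable t.+1); exact: state_info.
have bS i : bmeas (fun w => (state u t w == i)%:R * F i w).
  by apply: bmeasM => //; exact: bmeas_eq.
have -> : (fun w => F (state u t w) w)
    = (fun w => \sum_(i < M) (state u t w == i)%:R * F i w).
  by apply/funext => w; rewrite (sum_state t (F^~ w)).
split; first exact: bmeas_sum.
rewrite mean_sum// mean_sum; last by move=> i; exact: bmeasZ.
apply: eq_bigr => i _; rewrite meanZ//.
apply: (mean_indep (info_sigma t) (@info_measurable t) (c := c)) => //.
  by case: hp.
by move=> B GB; case: hf => _ _ _ h _; exact: h.
Qed.

(** Exponential moment of a centred bounded walk, one independent factor per slot: centring kills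
    the linear term, so each factor is at most [1 + 2 * s ^+ 2 <= expR (2 * s ^+ 2)]. *)
Lemma mean_expR_walk (c : 'I_M -> R) s t : (forall i, `|c i| <= 1) ->
  \sum_(i < M) p 0 i * c i = 0 -> 0 <= s <= 2^-1 ->
  bmeas (fun w => expR (s * \sum_(tau < t) c (state u tau w))) /\
  mean P (fun w => expR (s * \sum_(tau < t) c (state u tau w)))
    <= expR (2 * s ^+ 2 * t%:R).
Proof.
move=> c1 c0 /andP[s0 s2]; have [p0 p1] := hp.
have aW n : adapted_to (info u n)
    (fun w => expR (s * \sum_(tau < n) c (state u tau w))).
  apply: (adapted_comp (info_sigma n) (f := fun x => expR (s * x))).
    exact: measurableT_comp.
  apply: (adapted_sum (info_sigma n)) => tau.
  exact: adapted_state.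
have W n w : 0 <= expR (s * \sum_(tau < n) c (state u tau w)) <= expR (s * n%:R).
  rewrite expR_ge0 ler_expR ler_wpM2l//.
  rewrite -[X in _ <= X%:R]card_ord -sumr_const; apply: ler_sum => i _.
  exact: le_trans (ler_norm _) (c1 _).
have bW n : bmeas (fun w => expR (s * \sum_(tau < n) c (state u tau w))).
  apply: (adapted_bmeas (@info_measurable n) (c := expR (s * n%:R))) => // w.
  by have /andP[W0 W1] := W n w; rewrite ger0_norm.
split=> //; elim: t => [|t IHt].
  rewrite (_ : (fun w => _) = fun=> 1) ?mean_cst ?mulr0 ?expR0//.
  by apply/funext => w; rewrite big_ord0 mulr0 expR0.
pose F i w := expR (s * c i) * expR (s * \sum_(tau < t) c (state u tau w)).
have cs i : s * c i <= s by rewrite ler_piMr// (le_trans (ler_norm _) (c1 _)).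
have aF i : adapted_to (info u t) (F i).
  exact: (adaptedM (info_sigma t) (adapted_cst (info_sigma t) _) (aW t)).
have Fb i w : `|F i w| <= expR s * expR (s * t%:R).
  rewrite ger0_norm ?mulr_ge0 ?expR_ge0// ler_pM ?expR_ge0 ?ler_expR ?cs//.
  by rewrite -ler_expR; case/andP: (W t w).
have [_] := mean_state aF Fb.
have -> : (fun w => F (state u t w) w)
    = (fun w => expR (s * \sum_(tau < t.+1) c (state u tau w))).
  by apply/funext => w; rewrite big_ord_recr /= mulrDr expRD mulrC.
move=> ->.
have -> : (fun w => \sum_(i < M) p 0 i * F i w) = (fun w =>
    (\sum_(i < M) p 0 i * expR (s * c i))
      * expR (s * \sum_(tau < t) c (state u tau w))).
  by apply/funext => w; rewrite mulr_suml; apply: eq_bigr => i _; rewrite mulrA.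
rewrite meanZ// -[t.+1%:R]natr1 mulrDr mulr1 expRD mulrC.
apply: ler_pM => //; first by apply: mean_ge0 => w; exact: expR_ge0.
  by apply: sumr_ge0 => i _; rewrite mulr_ge0// expR_ge0.
apply: le_trans (expR_ge1Dx _).
have -> : 1 + 2 * s ^+ 2 = \sum_(i < M) p 0 i * (1 + s * c i + 2 * s ^+ 2).
  under eq_bigr do rewrite -addrA mulrDr mulr1 mulrDr mulrCA.
  by rewrite !big_split /= -mulr_sumr -mulr_suml c0 p1; ring.
apply: ler_sum => i _; apply: ler_wpM2l => //.
apply: le_trans (expR_le_quad (le_trans (cs i) s2)) _.
rewrite lerD2l ler_pM2l// exprMn ler_piMr ?sqr_ge0//.
by rewrite -real_normK ?num_real// exprn_ile1.
Qed.

(** Chernoff bound: the indicator of [B] is dominated by a sum of exponentials over the [2 * M]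
    pairs of a state and a sign of the deviation. *)
Lemma mean_bad_le (B : Omega -> bool) (eps s : R) t : (0 < M)%N ->
  measurable [set w | B w] ->
  (forall w, B w -> exists i, eps < `|empirical_dist R u t w 0 i - p 0 i|) ->
  0 <= s <= 2^-1 ->
  mean P (fun w => (B w)%:R) <= 2 * M%:R * expR ((2 * s ^+ 2 - s * eps) * t%:R).
Proof.
move=> M0 mB Bdev sb; have [p0 p1] := hp; have /andP[s0 s2] := sb.
have p_le1 i : p 0 i <= 1.
  by rewrite -p1 (bigD1 i)//= lerDl sumr_ge0.
pose c (b : bool) i (k : 'I_M) : R := (-1) ^+ b * ((k == i)%:R - p 0 i).
pose W b i w := expR (s * \sum_(tau < t) c b i (state u tau w)).
have c1 b i k : `|c b i k| <= 1.
  rewrite normrM normrX normrN1 expr1n mul1r ler_norml.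
  by have := p0 i; have := p_le1 i; case: (k == i) => /= *; apply/andP; split; lra.
have c0 b i : \sum_(k < M) p 0 k * c b i k = 0.
  under eq_bigr do rewrite /c mulrCA mulrBr.
  rewrite -mulr_sumr sumrB -mulr_suml p1 (bigD1 i)//= eqxx big1 => [|k /negbTE ->].
    by rewrite /= mulr1 addr0 mul1r subrr mulr0.
  by rewrite mulr0.
have WE b i := mean_expR_walk t (c1 b i) (c0 b i) sb.
pose X w := \sum_(i < M) expR (- (s * eps * t%:R)) * (W false i w + W true i w).
have bX i : bmeas (fun w => expR (- (s * eps * t%:R)) * (W false i w + W true i w)).
  by apply: bmeasZ; apply: bmeasD; [case: (WE false i) | case: (WE true i)].
have bB : bmeas (fun w => (B w)%:R : R).
  rewrite (_ : (fun w => _) = (fun w => (B w == true)%:R)).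
    by apply: bmeas_eq.
  by apply/funext => w; rewrite eqb_id.
apply: (@le_trans _ _ (mean P X)).
  apply: mean_le => // [|w]; first exact: bmeas_sum.
  case: (boolP (B w)) => [/Bdev[i dev]|_]; last first.
    by apply: sumr_ge0 => i _; rewrite mulr_ge0 ?addr_ge0 ?expR_ge0.
  have W0 k : 0 <= expR (- (s * eps * t%:R)) * (W false k w + W true k w).
    by rewrite mulr_ge0 ?addr_ge0 ?expR_ge0.
  rewrite /X (bigD1 i)//=; apply: ler_wpDr; first exact: sumr_ge0.
  pose D := \sum_(tau < t) ((state u tau w == i)%:R - p 0 i) : R.
  have Wd b : W b i w = expR (s * ((-1) ^+ b * D)) by rewrite /W -mulr_sumr.
  have epsD : eps * t%:R <= `|D|.
    move: dev; rewrite /D sumrB -natr_sum sumr_const card_ord mxE -[p 0 i *+ t]mulr_natr.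
    (* At slot 0, where the empirical vector is null by convention, the left-hand side vanishes. *)
    have [->|t0] := posnP t; first by rewrite mulr0 normr_ge0.
    have t0' : 0 < t%:R :> R by rewrite ltr0n.
    move=> /ltW; rewrite -(ler_pM2r t0') -[X in _ <= _ * X](gtr0_norm t0') -normrM.
    by rewrite mulrBl divfK ?gt_eqF.
  rewrite !Wd expr0 expr1 mul1r mulN1r mulrDr -!expRD.
  have [Dge|Dlt] := leP 0 D.
    apply: ler_wpDr; rewrite ?expR_ge0// -[X in X <= _]expR0 ler_expR.
    rewrite ger0_norm// in epsD; rewrite addrC subr_ge0 -mulrA.
    exact: ler_wpM2l.
  apply: ler_wpDl; rewrite ?expR_ge0// -[X in X <= _]expR0 ler_expR.
  rewrite ltr0_norm// in epsD; rewrite addrC subr_ge0 -mulrA.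
  exact: ler_wpM2l.
rewrite mean_sum//; set E := expR ((_ - _) * _).
have -> : 2 * M%:R * E = \sum_(i < M) 2 * E.
  by rewrite sumr_const card_ord -mulr_natr; ring.
apply: ler_sum => i _.
have [b1 e1] := WE false i; have [b2 e2] := WE true i.
rewrite meanZ ?meanD//; last exact: bmeasD.
rewrite /E mulrBl expRD mulrC mulrA ler_pM2r ?expR_gt0//.
by rewrite mulrDl mul1r lerD.
Qed.

End state_process.

(** * Queues *)

Lemma sqr_max0_sub_le (R : realType) (x y : R) : 0 <= y ->
  (Num.max x 0 - y) ^+ 2 <= (x - y) ^+ 2.
Proof. by move=> y0; case: (leP x 0) => x0 //; nra. Qed.

Section queue_dynamics.
Variables (R : realType) (r M : nat) (T : topologicalType).
Variables (net : network R r M T) (p : 'rV[R]_M) (delta : R).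
Hypothesis hnet : network_axioms net delta.
Context d (Omega : measurableType d) (P : probability Omega R).
Variable u : controlled_process M T Omega.
Hypothesis hf : feasible net p P u.

Definition increment t w : 'rV[R]_r := drift net (state u t w) (action u t w).

Lemma action_in t w : actions net (state u t w) (action u t w).
Proof. by case: hf => _ _ _ _ [h _]; exact: h. Qed.

Lemma increment_bound t w j : `|increment t w 0 j| <= delta.
Proof. exact: drift_bound (action_in t w) j. Qed.

Lemma adapted_increment t j :
  adapted_to (info u t.+1) (fun w => increment t w 0 j).
Proof.
under eq_fun do rewrite /increment /drift !mxE.
by apply: (adaptedB (info_sigma hf t.+1)); case: hf => _ _ _ _ [_ /(_ t)[]].
Qed.

Lemma adapted_cost t :
  adapted_to (info u t.+1) (fun w => cost net (state u t w) (action u t w)).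
Proof. by case: hf => _ _ _ _ [_ /(_ t)[]]. Qed.

Lemma queueS t w j : queue net u t.+1 w 0 j =
  Num.max (queue net u t w 0 j + increment t w 0 j) 0.
Proof. by rewrite /= /increment /drift !mxE; congr (Num.max _ 0); ring. Qed.

Lemma queue_ge0 t w j : 0 <= queue net u t w 0 j.
Proof.
by case: t => [|t]; [rewrite mxE | rewrite queueS le_max lexx orbT].
Qed.

Lemma adapted_queue t j : adapted_to (info u t) (fun w => queue net u t w 0 j).
Proof.
elim: t => [|t IHt].
  by rewrite (_ : (fun w => _) = fun=> 0); [exact: (adapted_cst (info_sigma hf 0)) |
    apply/funext => w; rewrite mxE].
under eq_fun do rewrite queueS.
apply: (adapted_max (info_sigma hf t.+1)); last exact: (adapted_cst (info_sigma hf _)).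
apply: (adaptedD (info_sigma hf t.+1)); last exact: adapted_increment.
exact: (adapted_le hf (leqnSn t)).
Qed.

Variable L : R.
Hypothesis L0 : 0 <= L.

(** [L] is the common entry of [theta]; once [beta t] equals the dual maximizer, this is also the
    displacement of the effective backlog from that maximizer. *)
Definition deviation t w : 'rV[R]_r := queue net u t w - const_mx L.

Lemma deviationE t w j : deviation t w 0 j = queue net u t w 0 j - L.
Proof. by rewrite /deviation; set q := queue net u t w; rewrite !mxE. Qed.

Definition dist t w : R := enorm (deviation t w).

Lemma dist_ge0 t w : 0 <= dist t w.
Proof. exact: enorm_ge0. Qed.

Lemma adapted_dist t : adapted_to (info u t) (dist t).
Proof.
have sG := info_sigma hf t.
apply: (adapted_comp sG (f := Num.sqrt)).
  exact: (continuous_measurable_fun (@sqrt_continuous R)).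
apply: (adapted_sum sG) => j; under eq_fun do rewrite expr2 deviationE.
by apply: (adaptedM sG); apply: (adaptedB sG); try exact: adapted_queue;
  exact: (adapted_cst sG).
Qed.

(* The projection onto the nonnegative orthant does not increase the distance
   to the point [const_mx L] of that orthant. *)
Lemma sqr_dist_step t w : dist t.+1 w ^+ 2 <=
  dist t w ^+ 2 + 2 * dot (deviation t w) (increment t w) + (r%:R * delta) ^+ 2.
Proof.
have d0 : (0 < r)%N -> 0 <= delta.
  by move=> r0; apply: le_trans (normr_ge0 _) (increment_bound t w (Ordinal r0)).
have ib : enorm (increment t w) ^+ 2 <= (r%:R * delta) ^+ 2.
  have [r0|r0] := posnP r; last by apply: sqr_enorm_le (increment_bound t w); exact: d0.
  by rewrite sqr_enorm big1 ?sqr_ge0// => j; move: (ltn_ord j); rewrite {2}r0.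
apply: le_trans (_ : enorm (deviation t w + increment t w) ^+ 2 <= _); last first.
  by rewrite sqr_enormD lerD2l.
rewrite !sqr_enorm; apply: ler_sum => j _.
rewrite [X in _ <= X ^+ 2]mxE !deviationE queueS.
have -> : queue net u t w 0 j - L + increment t w 0 j
  = queue net u t w 0 j + increment t w 0 j - L by rewrite addrAC.
exact: sqr_max0_sub_le.
Qed.

Lemma dot_increment_bound t w (v : 'rV[R]_r) :
  `|dot v (increment t w)| <= r%:R * delta * enorm v.
Proof. exact: dot_drift_bound (action_in t w). Qed.

Lemma dist_step t w : dist t.+1 w <= dist t w + r%:R * delta.
Proof.
have d0 : 0 <= r%:R * delta.
  have [->|r0] := posnP r; first by rewrite mul0r.
  apply: mulr_ge0 => //.
  exact: le_trans (normr_ge0 _) (increment_bound t w (Ordinal r0)).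
rewrite -ler_sqr ?nnegrE ?addr_ge0 ?dist_ge0//.
apply: le_trans (sqr_dist_step t w) _.
have := le_trans (ler_norm _) (dot_increment_bound t w (deviation t w)).
by rewrite -/(dist t w); nra.
Qed.

Lemma dist_le t w :
  dist t w <= enorm (const_mx L : 'rV[R]_r) + r%:R * delta * t%:R.
Proof.
elim: t => [|t IHt].
  by rewrite mulr0 addr0 /dist /deviation /= sub0r enormN.
by apply: le_trans (dist_step t w) _; rewrite -[t.+1%:R]natr1; lra.
Qed.

Lemma queue_le_dist t w j : queue net u t w 0 j <= L + dist t w.
Proof.
have := coord_le_enorm (deviation t w) j; rewrite deviationE => h.
by have := le_trans (ler_norm _) h; rewrite /dist; lra.
Qed.

(* The service wasted by an empty queue is at most [delta], and it is nonzero
   only when the queue is below [delta], that is when [dist] exceeds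
   [L - delta]; the exponential dominates this indicator. *)
Lemma dot_increment_ge t w (g : 'rV[R]_r) K : 0 < K -> nonneg_vec g ->
  - dot g (increment t w) <= dot g (queue net u t w) - dot g (queue net u t.+1 w)
    + (\sum_(j < r) g 0 j) * (delta * expR (K * (dist t w - L + delta))).
Proof.
move=> K0 g0; rewrite mulr_suml -sumrB -sumrN -big_split; apply: ler_sum => j _ /=.
rewrite -mulrN -mulrBr -mulrDr; apply: ler_wpM2l => //.
set E := expR _; rewrite -/(queue net u t.+1 w) queueS.
set q : R := queue net u t w 0 j; set a : R := increment t w 0 j.
have q0 : 0 <= q by exact: queue_ge0.
have := increment_bound t w j; rewrite -/a ler_norml => /andP[a_ge _].
have E0 : 0 < E by exact: expR_gt0.
have d0 : 0 <= delta.
  exact: le_trans (normr_ge0 _) (increment_bound t w j).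
have [h|h] := leP 0 (q + a); first by nra.
have : 1 <= E.
  rewrite -[X in X <= _]expR0 ler_expR mulr_ge0 ?ltW//.
  have := coord_le_enorm (deviation t w) j; rewrite deviationE -/q -/(dist t w).
  by rewrite distrC => hd; have := le_trans (ler_norm _) hd; lra.
nra.
Qed.

End queue_dynamics.

(** * Drift under OLAC *)

Lemma sum_drift_le (R : realFieldType) (phi y z : nat -> R) :
  (forall t, phi t.+1 + y t <= phi t + z t) ->
  forall t, phi t + \sum_(tau < t) y tau <= phi 0 + \sum_(tau < t) z tau.
Proof.
move=> step; elim=> [|t IHt]; first by rewrite !big_ord0.
by rewrite !big_ord_recr /=; have := step t; lra.
Qed.

Section olac_policy.
Variables (R : realType) (r M : nat) (T : topologicalType).
Variables (net : network R r M T) (p : 'rV[R]_M) (delta : R).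
Hypothesis hnet : network_axioms net delta.
Hypothesis act0 : forall i, actions net i !=set0.
Hypothesis hp : distribution_vec p.
Context d (Omega : measurableType d) (P : probability Omega R).
Variable u : controlled_process M T Omega.
Hypothesis hf : feasible net p P u.
Variables (V L : R) (beta : nat -> Omega -> 'rV[R]_r).
Hypotheses (V0 : 0 < V) (L0 : 0 <= L) (r0 : (0 < r)%N) (delta0 : 0 < delta).
Hypothesis holac : olac net V (const_mx L) u beta.
Hypothesis hcount : countable_state_space net (const_mx L) u beta.
Variables (g : 'rV[R]_r) (rho K : R).
Hypothesis g0 : nonneg_vec g.
Hypothesis polyg : forall v,
  dual net p V v + rho * enorm (v - g) <= dual net p V g.

Let b := r%:R * delta.
Let Q t w := effective_backlog net (const_mx L) u beta t w.

Lemma incr_bound_gt0 : 0 < b.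
Proof. by rewrite mulr_gt0// ltr0n. Qed.
Let b0 := incr_bound_gt0.

(** The OLAC payoff is minus the Lagrangian with multiplier [Q t w], so the chosen action attains
    the infimum defining the state dual. *)
Lemma lagr_action_le t w :
  lagr net V (state u t w) (action u t w) (Q t w)
    <= state_dual net V (state u t w) (Q t w).
Proof.
apply: (le_state_dual hnet act0) => x ax; case: holac => _ _ /(_ t w x ax).
have payE y : - V * cost net (state u t w) y
    + \sum_(j < r) Q t w 0 j * (service net (state u t w) y 0 j
                                - arrival net (state u t w) y 0 j)
    = - lagr net V (state u t w) y (Q t w).
  rewrite /lagr /dot opprD mulNr -sumrN; congr (_ + _); apply: eq_bigr => j _.
  by rewrite !mxE -mulrN opprB.
by rewrite /= -/(Q t w) !payE lerN2.
Qed.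

(** The countable state space enters here: the level sets of the backlog are finite intersections of
    events known at slot [t]. *)
Lemma adapted_backlog t (F : 'rV[R]_r -> R) :
  adapted_to (info u t) (fun w => F (Q t w)).
Proof.
have sG := info_sigma hf t.
have aQ j : adapted_to (info u t) (fun w => Q t w 0 j).
  have -> : (fun w => Q t w 0 j)
      = (fun w => queue net u t w 0 j + beta t w 0 j - L).
    apply/funext => w; rewrite /Q /effective_backlog.
    by set q := queue net u t w; rewrite !mxE.
  apply: (adaptedB sG); last exact: (adapted_cst sG).
  apply: (adaptedD sG); first exact: (adapted_queue hf).
  by case: holac => h _ _; exact: h.
apply: (adapted_countable sG F hcount) => [w|v _]; first by exists t, w.
rewrite (_ : [set w | _] = [set w | forall j, Q t w 0 j = v 0 j]).
  apply: (sigma_forall sG) => j.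
  by have := aQ j [set v 0 j] (measurable_set1 _).
apply/seteqP; split => w /=; first by move=> <-.
by move=> h; apply/rowP.
Qed.

Lemma tuned_info t : info u t [set w | beta t w == g].
Proof.
have sG := info_sigma hf t.
rewrite (_ : [set w | _] = [set w | forall j, beta t w 0 j = g 0 j]).
  apply: (sigma_forall sG) => j; case: holac => h _ _.
  by have := h t j [set g 0 j] (measurable_set1 _).
apply/seteqP; split => w /=; first by move=> /eqP <-.
by move=> h; apply/eqP/rowP.
Qed.

Lemma bmeas_tuned t : bmeas (fun w => (beta t w == g)%:R : R).
Proof.
apply: (@adapted_bmeas _ _ _ _ (info_measurable hf (t := t)) _ 1).
  exact: (adapted_bool (info_sigma hf t) (tuned_info t)).
by move=> w; case: eqP; rewrite ?normr0 ?normr1.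
Qed.

Lemma backlog_tuned t w : beta t w = g -> Q t w - g = deviation net u L t w.
Proof.
by move=> bg; rewrite /Q /effective_backlog bg /deviation; apply/rowP => j;
  set q := queue net u t w; rewrite !mxE; ring.
Qed.

(** Whether [beta t] equals [g] is known before [S(t)] is drawn, so restricting to this event keeps
    the law [p] of the state. The bound on [F] is asked only there, since elsewhere [beta t] may be
    arbitrarily large. *)
Lemma mean_tuned t (F : 'I_M -> 'rV[R]_r -> R) c :
  (forall i w, beta t w = g -> `|F i (Q t w)| <= c) -> 0 <= c ->
  let X w := (beta t w == g)%:R * F (state u t w) (Q t w) in
  let Y w := (beta t w == g)%:R * \sum_(i < M) p 0 i * F i (Q t w) in
  [/\ bmeas X, bmeas Y & mean P X = mean P Y].
Proof.
move=> Fc c0 X Y; have sG := info_sigma hf t.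
pose G i w := (beta t w == g)%:R * F i (Q t w).
have aG i : adapted_to (info u t) (G i).
  apply: (adaptedM sG); last exact: adapted_backlog.
  exact: (adapted_bool sG (tuned_info t)).
have Gc i w : `|G i w| <= c.
  rewrite /G; have [bg|_] := eqVneq; last by rewrite mul0r normr0.
  by rewrite mul1r; exact: Fc.
have bG i : bmeas (G i).
  exact: (adapted_bmeas (info_measurable hf (t := t)) (aG i) (Gc i)).
have [bX ->] := mean_state hp hf aG Gc.
have -> : Y = (fun w => \sum_(i < M) p 0 i * G i w).
  by apply/funext => w; rewrite /Y mulr_sumr; apply: eq_bigr => i _; rewrite mulrCA.
by split=> //; apply: bmeas_sum => i; exact: bmeasZ.
Qed.

(** Supergradient inequality: the chosen action is optimal at [Q t w] and merely admissible at [g],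
    and the two Lagrangians differ by a linear term. *)
Lemma dot_increment_le_dual t w : beta t w = g ->
  dot (deviation net u L t w) (increment net u t w)
    <= state_dual net V (state u t w) (Q t w) - state_dual net V (state u t w) g.
Proof.
move=> bg; rewrite -(backlog_tuned bg) dotBl.
have := lagr_action_le t w.
have := state_dual_le hnet act0 V g (action_in hf t w).
by rewrite /lagr -/(increment net u t w); lra.
Qed.

(** * Negative drift of the exponential Lyapunov function *)

Hypotheses (rho0 : 0 < rho) (K0 : 0 < K).
Hypotheses (K4 : 4 * K * b <= 1) (K32 : 32 * K * b ^+ 2 <= rho).
Hypothesis Krho : K * rho <= 1.

Let lyap t w := expR (K * dist net u L t w).

Lemma lyap_ge1 t w : 1 <= lyap t w.
Proof.
rewrite -[X in X <= _]expR0 ler_expR mulr_ge0 ?dist_ge0//; exact: ltW.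
Qed.

Lemma lyap_step t w : lyap t.+1 w <= expR (K * b) * lyap t w.
Proof.
rewrite -expRD ler_expR -mulrDr ler_pM2l// addrC.
exact: (dist_step hnet hf L0).
Qed.

Let dist0 := enorm (const_mx L : 'rV[R]_r).

Lemma lyap_le t w : lyap t w <= expR (K * (dist0 + b * t%:R)).
Proof. by rewrite ler_expR ler_pM2l//; exact: (dist_le hnet hf L0). Qed.

Lemma bmeas_dist t : bmeas (dist net u L t).
Proof.
apply: (adapted_bmeas (info_measurable hf (t := t)) (c := dist0 + b * t%:R)).
  exact: (adapted_dist hf).
by move=> w; rewrite ger0_norm ?dist_ge0//; exact: (dist_le hnet hf L0).
Qed.

Lemma bmeas_lyap t : bmeas (lyap t).
Proof.
apply: (adapted_bmeas (info_measurable hf (t := t)) (c := expR (K * (dist0 + b * t%:R)))).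
  apply: (adapted_comp (info_sigma hf t) (f := fun x => expR (K * x))).
    exact: measurableT_comp.
  exact: (adapted_dist hf).
by move=> w; rewrite ger0_norm ?expR_ge0//; exact: lyap_le.
Qed.

Let radius := b + 2 * b ^+ 2 / rho.

Let bad t w : R := (beta t w != g)%:R.

Lemma badE t w : bad t w = 1 - (beta t w == g)%:R.
Proof. by rewrite /bad; case: eqP; rewrite /= ?subr0 ?subrr. Qed.

Lemma bmeas_bad t : bmeas (bad t).
Proof.
rewrite (_ : bad t = fun w => 1 - (beta t w == g)%:R); last first.
  by apply/funext => w; exact: badE.
apply: bmeasB; [exact: bmeas_cst | exact: bmeas_tuned].
Qed.

(** Three cases: a bad slot multiplies [lyap] by at most [expR (K * b)]; within [radius] the next
    value is bounded by a constant; beyond it, polyhedrality contributes [- K * rho] and the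
    second-order error at most [K * rho / 2]. *)
Lemma mean_lyap_step t : mean P (lyap t.+1) <=
  (1 - K * rho / 2) * mean P (lyap t) + expR (K * (radius + b))
  + expR (K * b) * mean P (fun w => bad t w * lyap t w).
Proof.
(* The one-step exponential bound with the inner product replaced by its supergradient bound: a
   function of the state and the backlog alone, hence in the scope of [mean_tuned]. *)
pose F i v := if radius <= enorm (v - g) then expR (K * enorm (v - g))
    * (1 + K * ((state_dual net V i v - state_dual net V i g) / enorm (v - g))
       + K * rho / 2) else 0.
have rad0 : 0 < radius.
  by apply: ltr_pwDl => //; apply: divr_ge0; [rewrite mulr_ge0 ?sqr_ge0|exact: ltW].
pose c := expR (K * (dist0 + b * t%:R)) * (1 + K * b + K * rho / 2).
have c0 : 0 <= c.
  apply: mulr_ge0; first exact: expR_ge0.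
  by have := mulr_gt0 K0 b0; have := mulr_gt0 K0 rho0; lra.
have Fc i w : beta t w = g -> `|F i (Q t w)| <= c.
  move=> bg; rewrite /F (backlog_tuned bg) -/(dist net u L t w).
  have [rd|_] := leP radius (dist net u L t w); last by rewrite normr0.
  have d0 : 0 < dist net u L t w by exact: lt_le_trans rad0 rd.
  rewrite normrM (ger0_norm (expR_ge0 _)); apply: ler_pM; rewrite ?expR_ge0//.
    exact: lyap_le.
  apply: le_trans (ler_normD _ _) _; apply: lerD; last first.
    by have := mulr_gt0 K0 rho0 => h; rewrite ger0_norm//; lra.
  apply: le_trans (ler_normD _ _) _; rewrite normr1 lerD2l normrM (gtr0_norm K0).
  rewrite ler_pM2l// normrM normfV (gtr0_norm d0) ler_pdivrMr//.
  by apply: le_trans (state_dual_lip hnet act0 _ _ _ _) _; rewrite (backlog_tuned bg).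
have [bX bY XY] := mean_tuned Fc c0.
have bbad := bmeasM (bmeas_bad t) (bmeas_lyap t).
pose D := expR (K * (radius + b)).
pose U w := (beta t w == g)%:R * F (state u t w) (Q t w) + D
  + expR (K * b) * (bad t w * lyap t w).
have bU : bmeas U.
  by apply: bmeasD; [apply: bmeasD => //; exact: bmeas_cst | exact: bmeasZ].
apply: (@le_trans _ _ (mean P U)).
  apply: mean_le => [||w]; [exact: bmeas_lyap | exact: bU | rewrite /U /bad].
  have [bg|_] := eqVneq (beta t w) g; last first.
    rewrite /= mul0r add0r mul1r; apply: ler_wpDl; first exact: expR_ge0.
    exact: lyap_step.
  rewrite /= mul1r mul0r mulr0 addr0 /F (backlog_tuned bg) -/(dist net u L t w).
  have [rd|dr] := leP radius (dist net u L t w); last first.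
    rewrite add0r /D ler_expR ler_pM2l//.
    by apply: le_trans (dist_step hnet hf L0 t w) _; rewrite lerD2r ltW.
  have d0 : 0 < dist net u L t w by exact: lt_le_trans rad0 rd.
  apply: ler_wpDr; first exact: expR_ge0.
  apply: le_trans (expR_norm_step (dist_ge0 _ _ _ _ _) b0 rho0 K0 K4 K32 rd
    (dot_increment_bound hnet hf t w (deviation net u L t w))
    (sqr_dist_step hnet hf L0 t w)) _.
  rewrite ler_pM2l ?expR_gt0// lerD2r lerD2l ler_pM2l// ler_pM2r ?invr_gt0//.
  exact: dot_increment_le_dual.
have -> : mean P U
    = mean P (fun w => (beta t w == g)%:R * \sum_(i < M) p 0 i * F i (Q t w))
    + D + expR (K * b) * mean P (fun w => bad t w * lyap t w).
  rewrite meanD ?meanD ?mean_cst ?meanZ ?XY//; first exact: bmeas_cst.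
    by apply: bmeasD => //; exact: bmeas_cst.
  exact: bmeasZ.
rewrite lerD2r lerD2r -meanZ; last exact: bmeas_lyap.
have a0 : 0 <= 1 - K * rho / 2 by have := Krho; lra.
apply: mean_le => // [|w]; first by apply: bmeasZ; exact: bmeas_lyap.
have [bg|_] := eqVneq (beta t w) g; last by rewrite mul0r mulr_ge0 ?expR_ge0.
rewrite mul1r /F (backlog_tuned bg) -/(dist net u L t w).
have [rd|dr] := leP radius (dist net u L t w); last first.
  by rewrite big1 ?mulr_ge0 ?expR_ge0// => i _; rewrite mulr0.
have d0 : 0 < dist net u L t w by exact: lt_le_trans rad0 rd.
set y := dist net u L t w in d0 *.
(* Averaging over the state turns state duals into the dual function, to which polyhedrality
   applies. *)
have -> : \sum_(i < M) p 0 i * (expR (K * y) * (1 + K * ((state_dual net V i (Q t w)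
    - state_dual net V i g) / y) + K * rho / 2))
  = expR (K * y) * (1 + K * ((dual net p V (Q t w) - dual net p V g) / y) + K * rho / 2).
  transitivity (expR (K * y) * ((\sum_(i < M) p 0 i) * (1 + K * rho / 2)
      + K / y * (dual net p V (Q t w) - dual net p V g))).
    rewrite /dual -sumrB mulr_suml mulr_sumr -big_split mulr_sumr.
    by apply: eq_bigr => i _ /=; ring.
  by rewrite (proj2 hp); congr (_ * _); ring.
rewrite mulrC ler_pM2r ?expR_gt0//.
have : (dual net p V (Q t w) - dual net p V g) / y <= - rho.
  by rewrite ler_pdivrMr//; have := polyg (Q t w);
    rewrite (backlog_tuned bg) -/(dist net u L t w) -/y; lra.
move=> h; have : K * ((dual net p V (Q t w) - dual net p V g) / y) <= K * - rho.
  by rewrite ler_pM2l.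
by lra.
Qed.

(** * Drift-plus-penalty, time-average cost and stability *)

Variables (c kappa B : R).
Hypothesis hdual : forall v, dual net p V v <= c.
Hypotheses (kappa0 : 0 < kappa) (Kb : K * b <= kappa).
Hypothesis hbad : forall t, mean P (bad t) <= B * expR (- (2 * kappa) * t%:R).

Let G := \sum_(j < r) g 0 j.
(** Coefficient of [lyap] in the cost of wasted service. [G] grows like [V], and the factor
    [expR (- K * L)] will compensate it. *)
Let gdelta := G * (delta * expR (K * (delta - L))).

Lemma sum_coord_ge0 : 0 <= G.
Proof. by apply: sumr_ge0 => j _. Qed.
Let G0 := sum_coord_ge0.

Let phi t w := dist net u L t w ^+ 2 / 2 + dot g (queue net u t w).

Lemma phi_ge0 t w : 0 <= phi t w.
Proof.
rewrite addr_ge0 ?divr_ge0 ?sqr_ge0//; apply: sumr_ge0 => j _.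
by rewrite mulr_ge0// queue_ge0.
Qed.

Lemma phi_le t w : phi t w <= lyap t w * (K ^- 2 + G * (L + K^-1)).
Proof.
rewrite mulrDr lerD//.
  by apply: sqr_le_expR => //; exact: dist_ge0.
have dotq : dot g (queue net u t w) <= G * (L + dist net u L t w).
  rewrite mulr_suml; apply: ler_sum => j _; apply: ler_wpM2l => //.
  exact: queue_le_dist.
apply: le_trans dotq _.
rewrite mulrCA; apply: ler_wpM2l => //; rewrite mulrDr lerD//.
  by rewrite mulrC ler_peMr// lyap_ge1.
exact: le_expR_div.
Qed.

Lemma bmeas_queue t j : bmeas (fun w => queue net u t w 0 j).
Proof.
apply: (adapted_bmeas (info_measurable hf (t := t)) (c := L + (dist0 + b * t%:R))).
  exact: (adapted_queue hf).
move=> w; rewrite ger0_norm ?queue_ge0//.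
apply: (le_trans (queue_le_dist net u L t w j)); rewrite lerD2l.
exact: (dist_le hnet hf L0).
Qed.

Lemma bmeas_phi t : bmeas (phi t).
Proof.
apply: bmeasD.
  apply: bmeasM; last exact: bmeas_cst.
  rewrite (_ : (fun w => _) = fun w => dist net u L t w * dist net u L t w).
    by apply: bmeasM; exact: bmeas_dist.
  by apply/funext => w; rewrite expr2.
by apply: bmeas_sum => j; apply: bmeasZ; exact: bmeas_queue.
Qed.

Let fcost t w := cost net (state u t w) (action u t w).

Lemma bmeas_cost t : bmeas (fcost t).
Proof.
apply: (adapted_bmeas (info_measurable hf (t := t.+1)) (c := delta)).
  exact: (adapted_cost hf).
by move=> w; apply: (cost_bound hnet); exact: (action_in hf).
Qed.

(** Everything lost in a bad slot, as a multiple of [lyap]. It depends on [V], but it multiplies a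
    sum bounded in [t], which disappears in the time average. *)
Let badcoef := `|c| + (V * delta + expR (K * b) * (K ^- 2 + G * (L + K^-1))).

Lemma mean_cost_step t : V * mean P (fcost t) <=
  c + (mean P (phi t) - mean P (phi t.+1)) + b ^+ 2 / 2 + gdelta * mean P (lyap t)
  + badcoef * mean P (fun w => bad t w * lyap t w).
Proof.
(* A slot-dependent bound, used for boundedness only and absent from the result. *)
pose m := \sum_(i < M) `|state_dual net V i g| + b * (dist0 + b * t%:R).
have dist00 : 0 <= dist0 by exact: enorm_ge0.
have m0 : 0 <= m.
  rewrite addr_ge0 ?sumr_ge0//; apply: mulr_ge0; first exact: ltW.
  by rewrite addr_ge0// mulr_ge0// ltW.
have Fc i w : beta t w = g -> `|state_dual net V i (Q t w)| <= m.
  move=> bg; rewrite -[X in `|X|](subrK (state_dual net V i g)) addrC.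
  apply: le_trans (ler_normD _ _) _; apply: lerD.
    by rewrite (bigD1 i)//= lerDl sumr_ge0.
  apply: le_trans (state_dual_lip hnet act0 _ _ _ _) _; rewrite (backlog_tuned bg).
  by apply: ler_wpM2l; [exact: ltW | exact: (dist_le hnet hf L0)].
have [bX bY XY] := mean_tuned Fc m0.
have bbad := bmeasM (bmeas_bad t) (bmeas_lyap t).
pose C1 := V * delta + expR (K * b) * (K ^- 2 + G * (L + K^-1)).
have C10 : 0 <= K ^- 2 + G * (L + K^-1).
  apply: addr_ge0; first by rewrite invr_ge0 exprn_ge0// ltW.
  by apply: mulr_ge0 => //; apply: addr_ge0 => //; rewrite invr_ge0 ltW.
have gd0 : 0 <= gdelta.
  by apply: mulr_ge0 => //; rewrite mulr_ge0 ?expR_ge0// ltW.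
pose U w := (beta t w == g)%:R * state_dual net V (state u t w) (Q t w)
  + ((phi t w - phi t.+1 w) + (b ^+ 2 / 2
  + (gdelta * lyap t w + C1 * (bad t w * lyap t w)))).
have bU1 : bmeas (fun w => gdelta * lyap t w + C1 * (bad t w * lyap t w)).
  by apply: bmeasD; [apply: bmeasZ; exact: bmeas_lyap | exact: bmeasZ].
have bU2 : bmeas (fun w => phi t w - phi t.+1 w).
  by apply: bmeasB; exact: bmeas_phi.
have bU3 := bmeasD (bmeas_cst _ (b ^+ 2 / 2)) bU1.
have bU4 := bmeasD bU2 bU3.
have bU : bmeas U by exact: bmeasD.
have EU : mean P U = mean P (fun w =>
      (beta t w == g)%:R * \sum_(i < M) p 0 i * state_dual net V i (Q t w))
    + ((mean P (phi t) - mean P (phi t.+1)) + (b ^+ 2 / 2 + (gdelta * mean P (lyap t)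
    + C1 * mean P (fun w => bad t w * lyap t w)))).
  rewrite /U (meanD P bX bU4) XY (meanD P bU2 bU3).
  rewrite (meanB P (bmeas_phi t) (bmeas_phi t.+1)).
  rewrite (meanD P (bmeas_cst _ _) bU1) mean_cst.
  rewrite (meanD P (bmeasZ _ (bmeas_lyap t)) (bmeasZ C1 bbad)).
  by rewrite (meanZ P _ (bmeas_lyap t)) (meanZ P _ bbad).
(* On bad slots the left side is zero while [c] may be negative, hence the correction by the
   absolute value of [c], absorbed by [lyap >= 1]. *)
have dualc : mean P (fun w =>
      (beta t w == g)%:R * \sum_(i < M) p 0 i * state_dual net V i (Q t w))
    <= c + `|c| * mean P (fun w => bad t w * lyap t w).
  have -> : c + `|c| * mean P (fun w => bad t w * lyap t w)
      = mean P (fun w => c + `|c| * (bad t w * lyap t w)).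
    by rewrite meanD ?mean_cst ?meanZ//; [exact: bmeas_cst | exact: bmeasZ].
  apply: mean_le => // [|w]; first by apply: bmeasD; [exact: bmeas_cst | exact: bmeasZ].
  rewrite /bad; have [_|_] := eqVneq.
    by rewrite mul1r mul0r mulr0 addr0; exact: hdual.
  rewrite /= mul0r mul1r.
  rewrite -lerBlDl sub0r; apply: (@le_trans _ _ `|c|).
    by rewrite -normrN ler_norm.
  by rewrite ler_peMr// lyap_ge1.
apply: (@le_trans _ _ (mean P U)); last first.
  rewrite EU /badcoef -/C1.
  have key (X z1 z2 z3 a1 k y : R) : X <= c + a1 * y ->
      X + (z1 + (z2 + (z3 + k * y))) <= c + z1 + z2 + z3 + (a1 + k) * y by lra.
  exact: key.
rewrite -meanZ; last exact: bmeas_cost.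
apply: mean_le => // [|w]; first by apply: bmeasZ; exact: bmeas_cost.
rewrite /U /bad; have [bg|_] := eqVneq (beta t w) g; last first.
  rewrite /= mul0r add0r mul1r.
  have := phi_ge0 t w; have := lyap_ge1 t w.
  have h1 : V * fcost t w <= V * delta * lyap t w.
    apply: (@le_trans _ _ (V * delta)).
      rewrite ler_pM2l//; apply: le_trans (ler_norm _) (cost_bound hnet _).
      exact: (action_in hf).
    by rewrite ler_peMr ?lyap_ge1// mulr_ge0// ltW.
  have h2 : phi t.+1 w <= expR (K * b) * (K ^- 2 + G * (L + K^-1)) * lyap t w.
    apply: le_trans (phi_le _ _) _; rewrite mulrAC; apply: ler_wpM2r => //.
    exact: lyap_step.
  have h3 : 0 <= gdelta * lyap t w by rewrite mulr_ge0// expR_ge0.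
  have := sqr_ge0 b; move: h1 h2 h3; rewrite /C1 mulrDl; lra.
rewrite /= mul1r mul0r mulr0 addr0.
have h1 := lagr_action_le t w.
have dotQ : dot (Q t w) (increment net u t w) = dot (deviation net u L t w)
    (increment net u t w) + dot g (increment net u t w).
  by rewrite -(backlog_tuned bg) dotBl subrK.
rewrite /lagr -/(increment net u t w) dotQ in h1.
have h2 := sqr_dist_step hnet hf L0 t w.
have h3 := dot_increment_ge hnet hf L t w K0 g0.
have : G * (delta * expR (K * (dist net u L t w - L + delta))) = gdelta * lyap t w.
  by rewrite /gdelta -!mulrA /lyap -expRD; congr (_ * (_ * expR _)); ring.
rewrite -/G in h3; move: h1 h2 h3; rewrite /phi -/(fcost t w) -/b.
by lra.
Qed.

Let badsum := expR (K * dist0) * B * (1 - expR (- kappa))^-1.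

(** [lyap] grows at most like [expR (K * b * t)] along every path, while bad slots have probability
    of order [expR (- 2 * kappa * t)]; as [K * b <= kappa], a geometric series remains. *)
Lemma sum_mean_bad_le t :
  \sum_(tau < t) mean P (fun w => bad tau w * lyap tau w) <= badsum.
Proof.
have B0 : 0 <= B.
  have := hbad 0; rewrite mulr0 expR0 mulr1; apply: le_trans.
  by apply: mean_ge0 => w; rewrite /bad ler0n.
have C0 : 0 <= expR (K * dist0) * B by rewrite mulr_ge0 ?expR_ge0.
apply: (@le_trans _ _ (\sum_(tau < t) expR (K * dist0) * B * expR (- kappa * tau%:R))).
  apply: ler_sum => tau _.
  apply: (@le_trans _ _ (expR (K * (dist0 + b * tau%:R)) * mean P (bad tau))).
    rewrite -meanZ; last exact: bmeas_bad.
    apply: mean_le => [||w].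
    - by apply: bmeasM; [exact: bmeas_bad | exact: bmeas_lyap].
    - by apply: bmeasZ; exact: bmeas_bad.
    by rewrite mulrC; apply: ler_wpM2r; [rewrite /bad ler0n | exact: lyap_le].
  apply: le_trans (ler_wpM2l (expR_ge0 _) (hbad tau)) _.
  rewrite mulrDr expRD -!mulrA; apply: ler_wpM2l; first exact: expR_ge0.
  rewrite mulrCA; apply: ler_wpM2l => //; rewrite -expRD ler_expR.
  have : K * b * tau%:R <= kappa * tau%:R by apply: ler_wpM2r.
  rewrite (_ : K * (r%:R * _) = K * b * tau%:R) => [h|]; last by rewrite !mulrA.
  have key (x k n : R) : x <= k * n -> x + - (2 * k) * n <= - k * n by lra.
  exact: key h.
by rewrite -mulr_sumr; apply: ler_wpM2l => //; exact: sum_expR_geometric_le.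
Qed.

Let lyapdrift := expR (K * (radius + b)).

Lemma sum_mean_lyap_le t : \sum_(tau < t) mean P (lyap tau) <=
  t%:R * (lyapdrift / (K * rho / 2))
  + (mean P (lyap 0) + expR (K * b) * badsum) / (K * rho / 2).
Proof.
have a0 : 0 < K * rho / 2 by rewrite divr_gt0// mulr_gt0.
pose e tau := mean P (fun w => bad tau w * lyap tau w).
have drift tau : mean P (lyap tau.+1) + K * rho / 2 * mean P (lyap tau)
    <= mean P (lyap tau) + (lyapdrift + expR (K * b) * e tau).
  rewrite -lerBrDr; apply: le_trans (mean_lyap_step tau) _.
  by rewrite le_eqVlt -/lyapdrift -/(e tau); apply/orP; left; apply/eqP; ring.
rewrite [t%:R * _]mulrA -mulrDl ler_pdivlMr// mulrC mulr_sumr.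
have := sum_drift_le (phi := fun tau => mean P (lyap tau)) drift t.
rewrite big_split /= sumr_const card_ord => tele.
apply: le_trans (_ : _ <= mean P (lyap t) + _) (le_trans tele _).
  by rewrite lerDr; apply: mean_ge0 => w; exact: expR_ge0.
rewrite addrCA -[lyapdrift *+ t]mulr_natl -mulr_sumr !lerD2l.
by rewrite ler_pM2l ?expR_gt0//; exact: sum_mean_bad_le.
Qed.

Lemma average_cost_le :
  (average_cost net P u
    <= ((c + b ^+ 2 / 2 + gdelta * (lyapdrift / (K * rho / 2))) / V)%:E)%E.
Proof.
have gd0 : 0 <= gdelta.
  by apply: mulr_ge0 => //; rewrite mulr_ge0 ?expR_ge0// ltW.
have bc0 : 0 <= badcoef.
  apply: addr_ge0 => //; apply: addr_ge0; first by rewrite mulr_ge0 ?ltW.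
  apply: mulr_ge0; first exact: expR_ge0.
  apply: addr_ge0; first by rewrite invr_ge0 exprn_ge0// ltW.
  by apply: mulr_ge0 => //; apply: addr_ge0 => //; rewrite invr_ge0 ltW.
pose e tau := mean P (fun w => bad tau w * lyap tau w).
have drift tau : mean P (phi tau.+1) + V * mean P (fcost tau) <= mean P (phi tau)
    + (c + b ^+ 2 / 2 + gdelta * mean P (lyap tau) + badcoef * e tau).
  rewrite -lerBrDl; apply: le_trans (mean_cost_step tau) _.
  by rewrite le_eqVlt -/(e tau); apply/orP; left; apply/eqP; ring.
rewrite /average_cost.
rewrite (_ : (fun tau => _) = (fun tau => (mean P (fcost tau))%:E)); last first.
  by apply/funext => tau; rewrite expectationE//; exact: bmeas_cost.
apply: (@time_average_le _ _ _ ((mean P (phi 0) + gdelta *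
  ((mean P (lyap 0) + expR (K * b) * badsum) / (K * rho / 2)) + badcoef * badsum) / V)).
move=> t; rewrite [t%:R * _]mulrA -mulrDl ler_pdivlMr// mulrC mulr_sumr.
have := sum_drift_le (phi := fun tau => mean P (phi tau)) drift t.
rewrite [in X in _ <= X]big_split [in X in _ <= X]big_split /= sumr_const card_ord.
rewrite -[_ *+ t]mulr_natl -[\sum_(i < t) gdelta * _]mulr_sumr.
rewrite -[\sum_(i < t) badcoef * _]mulr_sumr => tele.
apply: le_trans (_ : _ <= mean P (phi t) + _) (le_trans tele _).
  by rewrite lerDr; apply: mean_ge0 => w; exact: phi_ge0.
have h1 := ler_wpM2l gd0 (sum_mean_lyap_le t).
have h2 := ler_wpM2l bc0 (sum_mean_bad_le t).
apply: le_trans (lerD (lexx _) (lerD (lerD (lexx _) h1) h2)) _.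
by rewrite le_eqVlt; apply/orP; left; apply/eqP; ring.
Qed.

Lemma olac_stable : stable net P u.
Proof.
rewrite /stable.
pose q tau := \sum_(j < r) mean P (fun w => queue net u tau w 0 j).
rewrite (_ : (fun tau => _) = (fun tau => (q tau)%:E)); last first.
  apply/funext => tau; rewrite -sumEFin; apply: eq_bigr => j _.
  by rewrite expectationE//; exact: bmeas_queue.
apply: le_lt_trans (ltry _).
have qle tau : q tau <= r%:R * L + r%:R / K * mean P (lyap tau).
  have -> : r%:R * L + r%:R / K * mean P (lyap tau)
      = \sum_(j < r) (L + K^-1 * mean P (lyap tau)).
    by rewrite sumr_const card_ord -mulr_natr; ring.
  apply: ler_sum => j _.
  rewrite -meanZ; last exact: bmeas_lyap.
  rewrite -[X in _ <= X + _](mean_cst P) -meanD; [|exact: bmeas_cst|]; last first.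
    by apply: bmeasZ; exact: bmeas_lyap.
  apply: mean_le => [||w]; first exact: bmeas_queue.
    by apply: bmeasD; [exact: bmeas_cst | apply: bmeasZ; exact: bmeas_lyap].
  apply: (le_trans (queue_le_dist net u L tau w j)); rewrite lerD2l mulrC.
  exact: le_expR_div.
apply: (@time_average_le _ _ (r%:R * L + r%:R / K * (lyapdrift / (K * rho / 2)))
  (r%:R / K * ((mean P (lyap 0) + expR (K * b) * badsum) / (K * rho / 2)))) => t.
apply: (@le_trans _ _ (\sum_(tau < t) (r%:R * L + r%:R / K * mean P (lyap tau)))).
  by apply: ler_sum.
rewrite big_split /= sumr_const card_ord -mulr_natl -mulr_sumr.
have rK : 0 <= r%:R / K by rewrite divr_ge0 ?ler0n// ltW.
by have := ler_wpM2l rK (sum_mean_lyap_le t); rewrite mulrDr mulrDr; lra.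
Qed.

End olac_policy.

(** For [K * ln V >= 1], [K * ln V ^+ 2] is at least [ln V]. The squared logarithm thus beats the
    factor [V] however small [K] is, once [V] is large. *)
Lemma scaled_expR_sqr_ln_le1 (R : realType) (K V : R) :
  0 < K -> expR K^-1 <= V -> V * expR (- (K * ln V ^+ 2)) <= 1.
Proof.
move=> K0 KV; have V0 : 0 < V by apply: lt_le_trans KV; exact: expR_gt0.
have Kln : K^-1 <= ln V by rewrite -[K^-1]expRK ler_ln ?posrE ?expR_gt0.
have ln0 : 0 <= ln V by apply: le_trans Kln; rewrite invr_ge0 ltW.
rewrite expRN ler_pdivrMr ?expR_gt0// mul1r -[X in X <= _]lnK ?posrE//.
by rewrite ler_expR expr2 mulrA ler_peMl// -ler_pdivrMl// mulr1.
Qed.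

(** * Choice of constants independent of [V], and the two bounds on the cost *)

Theorem theorem2 (R : realType) (r M : nat) (T : topologicalType)
    (net : network R r M T) (p : 'rV[R]_M) (delta eps_s eta0 rho : R)
    (gamma0 : 'rV[R]_r)
    (hr : (0 < r)%N)
    (hp : distribution_vec p)
    (hdelta : 0 < delta)
    (hnet : network_axioms net delta)
    (heps : 0 < eps_s) (heta : 0 < eta0)
    (hA1 : slackness net p eps_s eta0)
    (hA2 : zero_drift_optimum net p)
    (hA3 : unique_dual_maximizer net p gamma0)
    (hrho : 0 < rho)
    (hpoly : polyhedral net p gamma0 rho) :
  exists C V0 : R, [/\ 0 < C, 1 <= V0 &
    forall V : R, V0 <= V ->
    forall (d : measure_display) (Omega : measurableType d)
      (P : probability Omega R) (u : controlled_process M T Omega)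
      (beta : nat -> Omega -> 'rV[R]_r),
      let theta : 'rV[R]_r := const_mx (ln V ^+ 2) in
      feasible net p P u ->
      olac net V theta u beta ->
      countable_state_space net theta u beta ->
      (`| average_cost net P u - optimal_cost net p | <= (C / V)%:E)%E].
Proof.
move: (hA2) => [x [w [mix optE drift0]]].
have act0 i : actions net i !=set0.
  by have [ax _ _] := mix i; exists (x i 0).
have M0 : (0 < M)%N.
  have [_ p1] := hp; rewrite lt0n; apply/eqP => M00.
  by move: p1; rewrite big1 => [|i _]; [move/eqP; rewrite eq_sym oner_eq0 |
    move: (ltn_ord i); rewrite {2}M00].
have [gamma0_ge0 _] := hA3.
set fstar := mixture_mean p x w (cost net) in optE.
(* Weak duality against the zero-drift mixture, whose multiplier term vanishes. *)
have wd V v : dual net p V v <= V * fstar.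
  apply: le_trans (weak_duality hnet act0 hp V v mix) _.
  by rewrite big1 ?addr0// => j _; rewrite drift0 mulr0.
have r0 : 0 < r%:R :> R by rewrite ltr0n.
have M0' : 0 < M%:R :> R by rewrite ltr0n.
pose b := r%:R * delta.
have b0 : 0 < b by exact: mulr_gt0.
(* An empirical error of at most [eps] uses up half of the polyhedral slope. *)
pose eps := rho / (2 * M%:R * b).
have eps0 : 0 < eps by rewrite divr_gt0// !mulr_gt0.
have epsE : M%:R * eps * b = rho / 2.
  by rewrite /eps; field; rewrite !gt_eqF.
(* [s <= 2^-1] is needed for the exponential moment, and [s <= eps / 4] makes the Chernoff exponent
   [2 * s ^+ 2 - s * eps] at most [- (2 * kappa)]. *)
pose s := Num.min 2^-1 (eps / 4).
have s0 : 0 < s by rewrite lt_min divr_gt0// invr_gt0 ltr0n.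
have s2 : s <= 2^-1 by rewrite ge_min lexx.
have s4 : s <= eps / 4 by rewrite ge_min lexx orbT.
pose kappa := s * eps / 4.
have kappa0 : 0 < kappa by rewrite divr_gt0// mulr_gt0.
(* One term for each of [K4], [K32], [Krho] and [Kb]. *)
pose K := Num.min (Num.min (4 * b)^-1 (rho / (32 * b ^+ 2)))
  (Num.min rho^-1 (kappa / b)).
have b2 : 0 < 32 * b ^+ 2 by rewrite mulr_gt0// exprn_gt0.
have K0 : 0 < K.
  by rewrite !lt_min !invr_gt0 hrho !divr_gt0// mulr_gt0.
have K4 : 4 * K * b <= 1.
  have : K <= (4 * b)^-1 by rewrite !ge_min lexx.
  by rewrite -div1r ler_pdivlMr ?mulr_gt0// mulrCA mulrA.
have K32 : 32 * K * b ^+ 2 <= rho.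
  have : K <= rho / (32 * b ^+ 2) by rewrite !ge_min lexx orbT.
  by rewrite ler_pdivlMr// mulrCA mulrA.
have Krho : K * rho <= 1.
  have : K <= rho^-1 by rewrite !ge_min lexx !orbT.
  by rewrite -div1r ler_pdivlMr.
have Kb : K * b <= kappa.
  have : K <= kappa / b by rewrite !ge_min lexx !orbT.
  by rewrite ler_pdivlMr.
pose G := \sum_(j < r) gamma0 0 j.
have G0 : 0 <= G by apply: sumr_ge0.
pose A := expR (K * (b + 2 * b ^+ 2 / rho + b)) / (K * rho / 2).
have A0 : 0 <= A by rewrite divr_ge0 ?expR_ge0// ltW// divr_gt0// mulr_gt0.
have GA0 : 0 <= G * (delta * expR (K * delta) * A).
  apply: mulr_ge0 => //; apply: mulr_ge0 => //.
  by apply: mulr_ge0; [exact: ltW | exact: expR_ge0].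
exists (b ^+ 2 / 2 + G * (delta * expR (K * delta) * A)), (Num.max 1 (expR K^-1)).
split.
- by apply: ltr_wpDr => //; rewrite divr_gt0// exprn_gt0.
- by rewrite le_max lexx.
move=> V; rewrite ge_max => /andP[V1 VK] d Omega P u beta theta hf holac hcount.
have V0 : 0 < V by exact: lt_le_trans V1.
have L0 : 0 <= ln V ^+ 2 by exact: sqr_ge0.
pose g := V *: gamma0.
have g0 : nonneg_vec g by move=> j; rewrite mxE mulr_ge0// ltW.
have polyg v : dual net p V v + rho * enorm (v - g) <= dual net p V g.
  exact: (polyhedral_scale hnet act0).
have hbad t : mean P (fun w => (beta t w != g)%:R)
    <= 2 * M%:R * expR (- (2 * kappa) * t%:R).
  apply: le_trans (mean_bad_le hp hf (eps := eps) (s := s) (t := t) M0 _ _ _) _.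
  - have := measurableC (info_measurable hf (tuned_info hf holac g t)).
    congr (measurable _); apply/seteqP; split => y /=.
      by move/negP.
    by move=> ?; exact/negP.
  (* Contrapositive: if all empirical frequencies are within [eps], then [beta t] equals [g]. *)
  - move=> y /eqP bg; apply: contra_notP bg => nodev.
    apply: (dual_solution_near hnet act0 (eps := eps) V0 gamma0_ge0 hpoly
      (q := empirical_dist R u t y)) => [i||].
    + by rewrite leNgt; apply/negP => dev; apply: nodev; exists i.
    + by rewrite -/b epsE; lra.
    + by case: holac => _ /(_ t y)[].
  - by rewrite s2 ltW.
  rewrite ler_pM2l ?mulr_gt0// ler_expR; apply: ler_wpM2r => //.
  have := ler_wpM2l (ltW s0) s4; rewrite /kappa expr2; lra.
have stab := olac_stable hnet act0 hp hf L0 hr hdelta holac hcount polyg hrho K0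
  K4 K32 Krho kappa0 Kb hbad.
have avg := average_cost_le hnet act0 hp hf V0 L0 hr hdelta holac hcount g0 polyg
  hrho K0 K4 K32 Krho (wd V) kappa0 Kb hbad.
(* Stability makes OLAC a competitor in the infimum defining the optimal cost. *)
have lower : (optimal_cost net p <= average_cost net P u)%E.
  by apply: ereal_inf_lbound; exists d, Omega, P, u.
rewrite -optE in lower *.
have {avg} upper : (average_cost net P u <= (fstar
    + (b ^+ 2 / 2 + G * (delta * expR (K * delta) * A)) / V)%:E)%E.
  apply: le_trans avg _; rewrite lee_fin -/b -/A.
  rewrite ler_pdivrMr// mulrDl divfK ?gt_eqF// [fstar * V]mulrC -addrA !lerD2l.
  have -> : \sum_(j < r) g 0 j = V * G.
    by rewrite mulr_sumr; apply: eq_bigr => j _; rewrite mxE.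
  have -> : K * (delta - ln V ^+ 2) = - (K * ln V ^+ 2) + K * delta by ring.
  rewrite expRD; set E := expR (- _); set F := expR (K * delta).
  have -> : V * G * (delta * (E * F)) * A = V * E * (G * (delta * F * A)) by ring.
  by rewrite ler_piMl// scaled_expR_sqr_ln_le1.
case: (average_cost net P u) lower upper => [a| |]//=.
rewrite !lee_fin => fa au; rewrite ger0_norm ?subr_ge0//; lra.
Qed.
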